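(* Let $G$ be a Lie group with Lie algebra $\mathfrak g$, and let $P=G\times\mathfrak g$ be equipped with a $G$-invariant complex structure $I$, with associated connection $1$-form $\theta$ and horizontal $1$-form $L$. Let $\mu:P\to\mathfrak g^*$ be a regular $G$-equivariant map, and let $\Phi$ be the function on $P$ with values in invertible linear maps $\mathfrak g^*\to\mathfrak g$ defined by $L=\Phi(D\mu)$. Then $\mu$ is a moment map for a $G$-invariant Kähler metric on $(P,I)$ if and only if $\Phi$ is symmetric and both $\Phi$ and $\Phi+\Phi\circ(\mathrm{ad}\,\mu\circ\Phi)^2$ are positive-definite (at every point of $P$). If this is the case, then the Kähler metric is given by $$g=\langle\Phi(D\mu),D\mu\rangle+\langle\Phi^{-1}(\theta),\theta\rangle+\langle\mu,[\Phi(D\mu),\theta]-[\theta,\Phi(D\mu)]\rangle$$ and its Kähler form $\omega$ by $$\omega=-d\langle\mu,\theta\rangle .$$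
   Context: $P=G\times\mathfrak g$ is regarded as a trivial principal $G$-bundle over $\mathfrak g$, with $G$ acting on the left. For $\rho\in\mathfrak g$, $\rho^*$ is the fundamental vector field on $P$ generated by $\rho$, so $[\rho^*,\tilde\rho^*]=-[\rho,\tilde\rho]^*$. The $G$-invariant complex structure $I$ is such that every tangent vector of $P$ is uniquely of the form $\rho^*+I\tilde\rho^*$ with $\rho,\tilde\rho\in\mathfrak g$. The $\mathfrak g$-valued $1$-forms $\theta$ (a connection form) and $L$ are defined by $\theta(\rho^*+I\tilde\rho^* )=\rho$ and $L(\rho^*+I\tilde\rho^* )=\tilde\rho$; $L$ is horizontal (it vanishes on vertical vectors and is equivariant for the adjoint action). Equivariance of $\mu$ is with respect to the coadjoint action on $\mathfrak g^*$. For $m\in\mathfrak g^*$ and $x\in\mathfrak g$, $[m,x]=-[x,m]\in\mathfrak g^*$ is defined by $\langle[m,x],y\rangle=\langle m,[x,y]\rangle$, and $\mathrm{ad}\,\mu(p):\mathfrak g\to\mathfrak g^*$ is defined by $\langle\mathrm{ad}\,\mu(p)(x),y\rangle=\langle\mu(p),[x,y]\rangle$. The covariant derivative is $D\mu=d\mu+[\mu,\theta]$, which vanishes on vertical vectors. ''Regular'' means that $D\mu$ is non-degenerate, i.e. restricts to an isomorphism from the horizontal space $\ker\theta$ onto $\mathfrak g^*$ at every point; hence $\Phi$ is well defined and invertible. A linear map $\Phi:\mathfrak g^*\to\mathfrak g$ is identified with the bilinear form $(x,y)\mapsto\langle x,\Phi(y)\rangle$ on $\mathfrak g^*$, and symmetry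 and positive-definiteness refer to this bilinear form. The Kähler form of $g$ is $\omega=g(I\cdot,\cdot)$, and $\mu$ is a moment map if $d\langle\mu,\rho\rangle=\omega(\rho^*,\cdot)$ for all $\rho\in\mathfrak g$. In the formula for $g$ each term is read as the bilinear form obtained by inserting the first vector in the first factor and the second vector in the second factor; e.g. $\langle\mu,[\Phi(D\mu),\theta]-[\theta,\Phi(D\mu)]\rangle(X,Y)=\langle\mu,[\Phi(D\mu(X)),\theta(Y)]-[\theta(X),\Phi(D\mu(Y))]\rangle$. *)

(* Defs.v *)
From HB Require Import structures.
From mathcomp Require Import all_boot all_order all_algebra.
From mathcomp Require Import all_classical all_reals all_analysis.
Import Order.TTheory GRing.Theory Num.Theory.
Import numFieldNormedType.Exports.

Set Implicit Arguments.
Unset Strict Implicit.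
Unset Printing Implicit Defensive.

Local Open Scope classical_set_scope.
Local Open Scope ring_scope.

(** Smooth maps between (finite-dimensional) normed spaces.  All directional
    derivatives are used, so that no basis is needed; [Ck k U f] is only meant
    for open [U]. *)

Fixpoint Ck (R : realType) (E F : normedModType R) (k : nat) (U : set E)
    (f : E -> F) : Prop :=
  (forall x, U x -> {for x, continuous f}) /\
  (if k is k'.+1 then
     forall v, (forall x, U x -> derivable f x v) /\ Ck k' U (fun x => 'D_v f x)
   else True).

Definition smooth_on (R : realType) (E F : normedModType R) (U : set E)
    (f : E -> F) : Prop := forall k, Ck k U f.

(** An atlas modelled on [E], indexed by points: [chart p] is a chart around
    [p], with domain [dom p] and inverse [chart_inv p] (junk outside the
    domain, resp. its image). *)

Record atlas (R : realType) (E : normedModType R) (M : Type) := Atlas {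
  dom : M -> set M;
  chart : M -> M -> E;
  chart_inv : M -> E -> M }.

Definition is_manifold (R : realType) (E : normedModType R)
    (M : topologicalType) (A : atlas E M) : Prop :=
  [/\ hausdorff_space M,
      @second_countable M,
      (forall p, [/\ dom A p p, open (dom A p), open (chart A p @` dom A p) &
         (forall q, dom A p q -> chart_inv A p (chart A p q) = q)]),
      (forall p q, dom A p q ->
         {for q, continuous (chart A p)} /\
         {for chart A p q, continuous (chart_inv A p)}) &
      (forall p q, smooth_on (chart A p @` (dom A p `&` dom A q))
         (chart A q \o chart_inv A p))].

Definition vector_atlas (R : realType) (E : normedModType R) : atlas E E :=
  Atlas (fun _ => setT) (fun _ x => x) (fun _ x => x).

Definition prod_atlas (R : realType) (E F : normedModType R) (M N : Type)
    (A : atlas E M) (B : atlas F N) : atlas (E * F)%type (M * N)%type :=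
  Atlas (fun p => dom A p.1 `*` dom B p.2)
        (fun p q => (chart A p.1 q.1, chart B p.2 q.2))
        (fun p x => (chart_inv A p.1 x.1, chart_inv B p.2 x.2)).

Section Manifold.
Context {R : realType} {E : normedModType R} {M : Type} (A : atlas E M).

Definition smooth_at (F : normedModType R) (f : M -> F) (p : M) : Prop :=
  exists2 U, open_nbhs (chart A p p) U & smooth_on U (f \o chart_inv A p).

Definition smooth (F : normedModType R) (f : M -> F) : Prop :=
  forall p, smooth_at f p.

(** The tangent space at [p] is identified with [E] by means of the preferred
    chart [chart p] at [p]: every tangent vector is given by its components in
    that chart. [tder p v f] is the derivative [v f = df(v)]. *)

Definition tder (F : normedModType R) (p : M) (v : E) (f : M -> F) : F :=
  'D_v (f \o chart_inv A p) (chart A p p).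

(** Smoothness of tensors and tensorial identities are tested on global vector
    fields, which is enough on a Hausdorff second countable manifold. *)

Definition smooth_vfield (X : M -> E) : Prop :=
  forall p, smooth_at (fun q => tder q (X q) (chart A p)) p.

(** The components of [[X, Y]] in a chart [x] are [X (Y x^i) - Y (X x^i)]. *)

Definition vbracket (X Y : M -> E) : M -> E := fun p =>
  tder p (X p) (fun q => tder q (Y q) (chart A p)) -
  tder p (Y p) (fun q => tder q (X q) (chart A p)).

(** Exterior derivatives of real 1- and 2-forms, without normalising factors. *)

Definition d1 (a : M -> E -> R) (X Y : M -> E) (p : M) : R :=
  tder p (X p) (fun q => a q (Y q) : R) - tder p (Y p) (fun q => a q (X q) : R)
  - a p (vbracket X Y p).

Definition d2 (w : M -> E -> E -> R) (X Y Z : M -> E) (p : M) : R :=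
  tder p (X p) (fun q => w q (Y q) (Z q) : R)
  - tder p (Y p) (fun q => w q (X q) (Z q) : R)
  + tder p (Z p) (fun q => w q (X q) (Y q) : R)
  - w p (vbracket X Y p) (Z p)
  + w p (vbracket X Z p) (Y p)
  - w p (vbracket Y Z p) (X p).

Definition app_vfield (I : M -> {linear E -> E}) (X : M -> E) : M -> E :=
  fun p => I p (X p).

Definition nijenhuis (I : M -> {linear E -> E}) (X Y : M -> E) : M -> E :=
  fun p => vbracket (app_vfield I X) (app_vfield I Y) p
    - I p (vbracket (app_vfield I X) Y p)
    - I p (vbracket X (app_vfield I Y) p)
    - vbracket X Y p.

Definition complex_structure (I : M -> {linear E -> E}) : Prop :=
  [/\ (forall X, smooth_vfield X -> smooth_vfield (app_vfield I X)),
      (forall p v, I p (I p v) = - v) &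
      (forall X Y, smooth_vfield X -> smooth_vfield Y ->
         forall p, nijenhuis I X Y p = 0)].

Definition riemannian_metric (g : M -> E -> E -> R) : Prop :=
  [/\ (forall p (a : R) u v w, g p (a *: u + v) w = a * g p u w + g p v w),
      (forall p u v, g p u v = g p v u),
      (forall p v, v != 0 -> 0 < g p v v) &
      (forall X Y, smooth_vfield X -> smooth_vfield Y ->
         smooth (fun p => g p (X p) (Y p) : R))].

Definition kahler_form (I : M -> {linear E -> E}) (g : M -> E -> E -> R) :
  M -> E -> E -> R := fun p v w => g p (I p v) w.

Definition kahler_metric (I : M -> {linear E -> E}) (g : M -> E -> E -> R) :
    Prop :=
  [/\ riemannian_metric g,
      (forall p v w, g p (I p v) (I p w) = g p v w) &
      (forall X Y Z, smooth_vfield X -> smooth_vfield Y -> smooth_vfield Z ->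
         forall p, d2 (kahler_form I g) X Y Z p = 0)].

End Manifold.

(** Differential of a map, from the tangent space at [p] to that at [f p]. *)

Definition push (R : realType) (E F : normedModType R) (M N : Type)
    (A : atlas E M) (B : atlas F N) (f : M -> N) (p : M) (v : E) : F :=
  tder A p v (fun q => chart B (f p) (f q)).

(** Charts are junk outside their domain, hence the explicit continuity. *)

Definition smooth_map (R : realType) (E F : normedModType R)
    (M N : topologicalType) (A : atlas E M) (B : atlas F N) (f : M -> N) :=
  continuous f /\ forall p, smooth_at A (fun q => chart B (f p) (f q)) p.

HB.mixin Record isLieGroup (R : realType) (n : nat) G
    of Group G & Topological G := {
  lie_atlas : atlas 'rV[R]_n G;
  lie_manifold : is_manifold lie_atlas;
  lie_mul_smooth : smooth_map (prod_atlas lie_atlas lie_atlas) lie_atlas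
    (fun xy : G * G => (xy.1 * xy.2)%g);
  lie_inv_smooth : smooth_map lie_atlas lie_atlas (fun x : G => (x^-1)%g) }.

#[short(type="lieGroupType")]
HB.structure Definition LieGroup (R : realType) (n : nat) :=
  {G of Group G & Topological G & isLieGroup R n G}.

(** The Lie algebra of a Lie group modelled on ['rV[R]_n] is its tangent space
    at the identity, so it is ['rV[R]_n] with the bracket [lie_bracket] below,
    which depends on the group; [bundleTangent] is the tangent space of
    [P = G * g]. *)

Notation lieAlg R n := 'rV[R]_n.
Notation lieDual R n := 'Hom('rV[R]_n, R^o).
Notation bundleTangent R n := ('rV[R]_n * 'rV[R]_n)%type.

Section LieGroupTheory.
Context {R : realType} {n : nat} (G : lieGroupType R n).

Local Notation atG := (@lie_atlas R n G).

Local Notation g := (lieAlg R n).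
Local Notation gdual := (lieDual R n).
Local Notation TP := (bundleTangent R n).

(** The left-invariant vector field with value [x] at the identity (its value
    at [a] is a tangent vector at [a * 1 = a]). *)

Definition left_vfield (x : g) : G -> g :=
  fun a => push atG atG (fun b => (a * b)%g) 1%g x.

Definition lie_bracket (x y : g) : g :=
  vbracket atG (left_vfield x) (left_vfield y) 1%g.

Definition Ad (a : G) (y : g) : g :=
  push atG atG (fun b => (a * b * a^-1)%g) 1%g y.

(** [[m, x]], that is [y |-> m [x, y]]. Here and below [linfun] packages maps
    that are linear for mathematical reasons (the bracket is bilinear, a
    differential is linear), without carrying the proof. *)

Definition dual_bracket (m : gdual) (x : g) : gdual :=
  linfun (fun y => m (lie_bracket x y) : R^o).

Definition ad_dual (m : gdual) : 'Hom(g, gdual) := linfun (dual_bracket m).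

(** The trivial bundle [P = G * g]; its tangent spaces are
    [TP = g * g]. *)

Definition bundle : Type := (G * g)%type.
Definition bundle_atlas : atlas TP bundle :=
  prod_atlas atG (vector_atlas g).
Local Notation P := bundle.
Local Notation atP := bundle_atlas.

Definition bundle_act (a : G) (p : P) : P := ((a * p.1)%g, p.2).

Definition act_push (a : G) (p : P) (v : TP) : TP :=
  push atP atP (bundle_act a) p v.

(** The fundamental vector field [x^*], the derivative at the identity of the
    orbit maps. *)

Definition fund (x : g) : P -> TP :=
  fun p => push atG atP (fun a => bundle_act a p) 1%g x.

Definition invariant_endo (I : P -> {linear TP -> TP}) : Prop :=
  forall a p v, I (bundle_act a p) (act_push a p v) = act_push a p (I p v).

Definition invariant_metric (h : P -> TP -> TP -> R) : Prop :=
  forall a p v w,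
    h (bundle_act a p) (act_push a p v) (act_push a p w) = h p v w.

Definition smooth_dual (mu : P -> gdual) : Prop :=
  forall x, smooth atP (fun p => mu p x : R).

Definition coadjoint_equivariant (mu : P -> gdual) : Prop :=
  forall a p x, mu (bundle_act a p) x = mu p (Ad a^-1%g x).

(** [D mu = d mu + [mu, theta]]. *)

Definition cov_der (theta : P -> {linear TP -> g}) (mu : P -> gdual)
    (p : P) (v : TP) : gdual :=
  linfun (fun x => tder atP p v (fun q => mu q x : R) : R^o)
  + dual_bracket (mu p) (theta p v).

Definition regular (theta : P -> {linear TP -> g}) (mu : P -> gdual) : Prop :=
  forall p m, exists! v, theta p v = 0 /\ cov_der theta mu p v = m.

Definition moment_map (I : P -> {linear TP -> TP}) (h : P -> TP -> TP -> R)
    (mu : P -> gdual) : Prop :=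
  forall x p v,
    tder atP p v (fun q => mu q x : R) = kahler_form I h p (fund x p) v.

(** Linear maps [g^* -> g] as bilinear forms on [g^*]. *)

Definition dual_symmetric (f : 'Hom(gdual, g)) : Prop :=
  forall x y : gdual, x (f y) = y (f x).

Definition dual_posdef (f : 'Hom(gdual, g)) : Prop :=
  forall x : gdual, x != 0 -> (0 : R) < x (f x).

End LieGroupTheory.

(* Main.v *)
Require Import Defs.
From HB Require Import structures.
From mathcomp Require Import all_boot all_order all_algebra.
From mathcomp Require Import all_classical all_reals all_analysis.
From mathcomp Require Import ring lra.
Import Order.TTheory GRing.Theory Num.Theory.
Import numFieldNormedType.Exports.
Set Implicit Arguments.
Unset Strict Implicit.
Unset Printing Implicit Defensive.
Local Open Scope classical_set_scope.
Local Open Scope ring_scope.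

(** Why the theorem holds.  Write [x^#] for the fundamental field [fund x] and
    [dmu x p v] for [d<mu,x>(v)].  A metric [h] for which [I] is orthogonal
    and [mu] is a moment map satisfies [h(I x^#, v) = d<mu,x>(v)], and every
    tangent vector is [v = theta(v)^# + I L(v)^#]; hence there is only one
    candidate,
       [moment_metric p v w = d<mu,theta v>(I w) + d<mu,L v>(w)]
    ([moment_metric_unique]), and the theorem reduces to deciding when this
    tensor is a Kaehler metric.  It is always hermitian and [G]-invariant with
    moment map [mu]; what depends on [Phi] is that it is symmetric, positive
    and closed.

    Symmetry and positivity are linear algebra at a point.  Equivariance of
    [mu] differentiates to [d<mu,x>(y^#) = <mu,[x,y]>]
    ([tder_fund_equivariant]), and [d<mu,x>(I y^#) = <Phi^-1(y), x>]
    because [L = Phi(D mu)].  Therefore, with [u = theta v] and [y = L v],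
       [g(v,v) = <Phi^-1 u, u> + <Phi^-1 y, y> + 2 <mu,[y,u]>],
    and completing the square in [u] leaves the value of
    [Phi + Phi (ad mu Phi)^2] at [Phi^-1 y] ([block_form_posdef]).

    Closedness and smoothness both follow from [omega = - d<mu,theta>]
    ([omega_d1]).  Both sides are tensors, so this is compared on the frame
    of the fields [x^#] and [I x^#].  Their brackets are
    [[x^#,y^#] = - [x,y]^#] and [[x^#,I y^#] = - I [x,y]^#], by one argument valid
    for every invariant family of vector fields ([vbracket_fund]), and
    [[I x^#,I y^#] = [x,y]^#] by the vanishing of the Nijenhuis tensor; the
    symmetry of [Phi] enters in the pair [(I x^#, y^#)].  Then
    [d omega = 0] is [d d = 0] ([d2_d1]), which for global vector fields
    amounts to [[X,Y] f = X Y f - Y X f] and the Jacobi identity.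

    Underneath lies the calculus of maps all of whose iterated directional
    derivatives exist and are continuous: in finite dimension such maps are
    differentiable ([C1_differentiable]), they compose ([Ck_comp]), and their
    second derivatives are symmetric ([Schwarz]).  Symmetry of second
    derivatives is the source of every bracket identity, including
    [d/da Ad(a^-1) y = [y,x]] at the identity along [x] ([tder_Ad_inv]). *)

(** * Mean values along lines *)
Section Line.
Context {R : realType} {E : normedModType R}.
Implicit Types (z v w : E).

Lemma is_derive_line (F : normedModType R) (f : E -> F) z v (s : R) :
  derivable f (z + s *: v) v ->
  is_derive s 1 (fun t : R => f (z + t *: v)) ('D_v f (z + s *: v)).
Proof.
have eqq : (fun h : R => h^-1 *: (((fun t : R => f (z + t *: v)) \o shift s)
    (h *: (1 : R)) - f (z + s *: v))) =
    (fun h : R => h^-1 *: ((f \o shift (z + s *: v)) (h *: v)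
       - f (z + s *: v))).
  apply/funext => h /=; congr (_ *: (f _ - _)).
  by rewrite scalerDl [h *: 1]mulr1 addrCA.
by move=> df; split; rewrite /derivable /derive eqq.
Qed.

Lemma MVT_line (f : E -> R) z v (t : R) :
  (forall s : R, `|s| <= `|t| -> derivable f (z + s *: v) v) ->
  exists2 s : R, `|s| <= `|t| & f (z + t *: v) - f z = t * 'D_v f (z + s *: v).
Proof.
move=> df; pose g (s : R) : R := f (z + s *: v).
have dg s : `|s| <= `|t| -> is_derive (s : R) (1 : R) g ('D_v f (z + s *: v)).
  by move=> st; apply: is_derive_line; exact: df.
have fz : f z = g 0 by rewrite /g scale0r addr0.
have cont (i : interval R) : (forall s, s \in i -> `|s| <= `|t|) ->
    {within [set` i], continuous g}.
  move=> it; apply: derivable_within_continuous => s /it /dg dgs.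
  exact: ex_derive.
case: (ltgtP t 0) => [t0|t0|->].
- have bd s : s \in `[t, 0] -> `|s| <= `|t|.
    rewrite in_itv /= => /andP[ts s0].
    by rewrite (ler0_norm s0) (ltr0_norm t0) lerN2.
  have [|s st e] := @MVT R g (fun s => 'D_v f (z + s *: v)) t 0 t0 _ (cont _ bd).
    by move=> s /subset_itv_oo_cc /bd /dg.
  exists s; first by apply: bd; apply: subset_itv_oo_cc.
  by rewrite fz -/(g t) -[LHS]opprK opprB e sub0r mulrN mulrC opprK.
- have bd s : s \in `[0, t] -> `|s| <= `|t|.
    rewrite in_itv /= => /andP[s0 st].
    by rewrite (ger0_norm s0) (gtr0_norm t0).
  have [|s st e] := @MVT R g (fun s => 'D_v f (z + s *: v)) 0 t t0 _ (cont _ bd).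
    by move=> s /subset_itv_oo_cc /bd /dg.
  exists s; first by apply: bd; apply: subset_itv_oo_cc.
  by rewrite fz -/(g t) e subr0 mulrC.
- by exists 0; rewrite ?normr0// scale0r addr0 subrr mul0r.
Qed.

(** Existence of [D_v f] near [x] and its continuity at [x] make the
    directional expansion uniform in the base point; this uniformity is what
    lets the increments along different basis vectors be added up. *)
Lemma derive_step (f : E -> R) x v (e : R) : 0 < e ->
  (\forall y \near x, derivable f y v) -> {for x, continuous ('D_v f)} ->
  \forall z \near x & t \near (0 : R),
    `|f (z + t *: v) - f z - t * 'D_v f x| <= e * `|t|.
Proof.
move=> e0 df cf.
have : \forall y \near x, derivable f y v /\ `|'D_v f x - 'D_v f y| <= e.
  near=> y; split; first by near: y.
  by near: y; move/cvgrPdist_le : cf; apply.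
move=> /nbhs_ballP[r /= r0 br].
have key : \forall z \near x & s \near (0 : R), ball x r (z + s *: v).
  have cadd : (fun p : E * R => p.1 + p.2 *: v) @ (x, (0:R)) --> x + 0 *: v.
    apply: cvgD; first exact: cvg_fst.
    by apply: cvgZr_tmp; exact: cvg_snd.
  have := cadd (ball x r); rewrite scale0r addr0 => /(_ (nbhsx_ballx _ _ r0)).
  by move=> [[A B] /= [nA nB] AB]; exists (A, B).
case: key => -[A B] /= [nA /nbhs_ballP[d /= d0 Bd]] AB.
exists (A, ball 0 d) => /=; first by split=> //; exact: nbhsx_ballx.
move=> -[z t] /= [Az td].
have ball0 s : `|s| <= `|t| -> ball x r (z + s *: v).
  move=> st; apply: (AB (z, s)) => /=; split=> //; apply: Bd.
  move: td; rewrite -!ball_normE /= !sub0r !normrN.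
  exact: le_lt_trans.
have [s st ->] : exists2 s : R, `|s| <= `|t| &
    f (z + t *: v) - f z = t * 'D_v f (z + s *: v).
  by apply: MVT_line => s /ball0 /br [].
rewrite -mulrBr normrM mulrC ler_wpM2r // distrC.
by case: (br _ (ball0 _ st)).
Unshelve. all: by end_near.
Qed.
End Line.

(** * Finite-dimensional normed spaces *)

(** A chosen basis with continuous coordinates. The basis is data: for products
    it is computed by splitting the index, so that coordinates of pairs reduce
    to coordinates of the components. *)
Class findim {R : realType} (E : normedModType R) := Findim {
  fdim : nat;
  fvec : 'I_fdim -> E;
  fcoord : 'I_fdim -> {linear E -> R};
  fcoord_cont : forall i, continuous (fcoord i);
  fcoordE : forall x, x = \sum_i fcoord i x *: fvec i }.

Lemma cvg_sum {R : realType} {E F : normedModType R} (J : Type) (r : seq J)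
    (f : J -> E -> F) (x : E) :
  (forall i, {for x, continuous (f i)}) ->
  {for x, continuous (fun y => \sum_(i <- r) f i y)}.
Proof.
by move=> cf; apply: cvg_big => [|i _]; [exact: add_continuous|exact: cf].
Qed.

Section FindimInstances.
Context {R : realType}.

Fact fcoordE_R (x : R) : x = \sum_(i < 1) (idfun : {linear R -> R}) x *: (1 : R).
Proof. by rewrite big_ord1 /= [_ *: _]mulr1. Qed.

Definition findim_R : findim (R : normedModType R) :=
  @Findim R R 1 (fun _ => 1) (fun _ => idfun) (fun _ x => cvg_id) fcoordE_R.

Definition row_coord n (i : 'I_n) (x : 'rV[R]_n) : R := x ord0 i.
Fact row_coord_linear n i : linear (@row_coord n i : 'rV[R]_n -> R).
Proof. by move=> a x y; rewrite /row_coord !mxE. Qed.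
HB.instance Definition _ n i := GRing.isLinear.Build R 'rV[R]_n R _ _
  (@row_coord_linear n i).

Definition findim_rV n : findim ('rV[R]_n : normedModType R) :=
  @Findim R _ n (fun i => delta_mx 0 i) (fun i => @row_coord n i)
    (fun i => @coord_continuous R 1 n ord0 i) (@row_sum_delta R n).

Variables (E F : normedModType R).
Context {fE : findim E} {fF : findim F}.

Definition pair_coord (i : 'I_(@fdim _ _ fE + @fdim _ _ fF)) (x : E * F) : R :=
  match fintype.split i with inl j => fcoord j x.1 | inr j => fcoord j x.2 end.
Fact pair_coord_linear i : linear (@pair_coord i : E * F -> R).
Proof.
by move=> a x y; rewrite /pair_coord; case: (fintype.split i) => j; rewrite linearP.
Qed.
HB.instance Definition _ i := GRing.isLinear.Build R (E * F)%type R _ _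
  (@pair_coord_linear i).

Definition pair_vec (i : 'I_(@fdim _ _ fE + @fdim _ _ fF)) : E * F :=
  match fintype.split i with inl j => (fvec j, 0) | inr j => (0, fvec j) end.

Fact pair_coord_cont i : continuous (pair_coord i).
Proof.
move=> x; rewrite /pair_coord; case: (fintype.split i) => j.
- by apply: (@continuous_comp _ _ _ (@fst E F) (fcoord j));
    [exact: cvg_fst|exact: fcoord_cont].
- by apply: (@continuous_comp _ _ _ (@snd E F) (fcoord j));
    [exact: cvg_snd|exact: fcoord_cont].
Qed.

Fact pair_coordE x : x = \sum_i pair_coord i x *: pair_vec i.
Proof.
case: x => [x y]; rewrite big_split_ord /= /pair_coord /pair_vec.
under eq_bigr do rewrite (unsplitK (inl _)) /=.
under [X in _ = _ + X]eq_bigr do rewrite (unsplitK (inr _)) /=.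
rewrite [x in LHS]fcoordE [y in LHS]fcoordE.
have sp (G H : normedModType R) m (u : 'I_m -> G) (v : 'I_m -> H) :
   \sum_i ((u i, v i) : G * H) = (\sum_i u i, \sum_i v i).
  by elim/big_ind3 : _ => // ? ? ? ? ? ? -> ->.
transitivity ((\sum_i (fcoord i x *: fvec i), 0) + (0, \sum_i (fcoord i y *: fvec i)) : E * F).
  by apply: injective_projections; rewrite /= ?addr0 ?add0r.
congr (_ + _).
  transitivity (\sum_i ((fcoord i x *: fvec i, 0) : E * F)).
    by rewrite sp; congr (_, _); rewrite big1.
  by apply: eq_bigr => i _; apply: injective_projections; rewrite //= scaler0.
transitivity (\sum_i ((0, fcoord i y *: fvec i) : E * F)).
  by rewrite sp; congr (_, _); rewrite big1.
by apply: eq_bigr => i _; apply: injective_projections; rewrite //= scaler0.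
Qed.

Definition findim_prod : findim ((E * F)%type : normedModType R) :=
  @Findim R _ (@fdim _ _ fE + @fdim _ _ fF) pair_vec (fun i => @pair_coord i)
    pair_coord_cont pair_coordE.
End FindimInstances.
#[export] Existing Instance findim_R.
#[export] Existing Instance findim_rV.
#[export] Existing Instance findim_prod.

Section Findim.
Context {R : realType} {E F : normedModType R} {fE : findim E} {fF : findim F}.

Lemma findim_linear_cont (l : {linear E -> F}) : continuous l.
Proof.
have -> : (l : E -> F) = (fun x => \sum_i (fcoord i x *: l (fvec i))).
  apply/funext => x; rewrite [x in LHS]fcoordE linear_sum.
  by apply: eq_bigr => i _; rewrite linearZ.
move=> x; apply: cvg_sum => i.
by apply: cvgZr_tmp; exact: fcoord_cont.
Qed.

(** The increment [h] is written as the sum of its coordinate vectors, added one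
    after the other; each step is controlled by [derive_step] at a base point
    that tends to [x] with [h]. *)
Lemma C1_differentiable (f : E -> R) (x : E) :
  (forall v, \forall y \near x, derivable f y v) ->
  (forall v, {for x, continuous ('D_v f)}) -> differentiable f x.
Proof.
move=> df cf.
pose d (h : E) : R := \sum_(i < @fdim _ _ fE) fcoord i h * 'D_(fvec i) f x.
have dlin : linear d.
  move=> a u v; rewrite /d scaler_sumr -big_split /=; apply: eq_bigr => i _.
  by rewrite linearP /= mulrDl [_ *: (_ * _)]mulrA.
pose dM := GRing.isLinear.Build _ _ _ _ _ dlin.
pose dL : {linear E -> R} := HB.pack d dM.
(* [P s h] is the part of [h] along the basis vectors listed in [s]. *)
pose P (s : seq 'I_(@fdim _ _ fE)) (h : E) := \sum_(i <- s) fcoord i h *: fvec i.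
have Pc s : continuous (P s).
  move=> y; apply: cvg_sum => i.
  by apply: cvgZr_tmp; exact: fcoord_cont.
have step (s : seq 'I_(@fdim _ _ fE)) (e : R) : 0 < e -> \forall h \near (0 : E),
    `|f (x + P s h) - f x - \sum_(i <- s) fcoord i h * 'D_(fvec i) f x|
      <= e * `|h|.
  elim: s e => [|i s IH] e e0.
    near=> h; rewrite /P !big_nil addr0 subrr subr0 normr0.
    by rewrite mulr_ge0// ltW.
  have [k k0 ck] := linear_lipschitz (@fcoord_cont _ _ fE i).
  have e20 : 0 < e / 2 by rewrite divr_gt0.
  have ek0 : 0 < e / 2 / k by rewrite divr_gt0.
  have := derive_step ek0 (df (fvec i)) (cf (fvec i)).
  move=> [[A B] /= [nA nB] AB].
  near=> h.
  have Ah : A (x + P s h).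
    near: h; have : (fun h => x + P s h) @ (0 : E) --> x + P s 0.
      by apply: cvgD; [exact: cvg_cst|exact: Pc].
    rewrite {2}/P big1; last by move=> j _; rewrite linear0 scale0r.
    by rewrite addr0; apply.
  have Bh : B (fcoord i h).
    near: h; have := @fcoord_cont _ _ fE i (0 : E); rewrite /continuous_at linear0.
    exact.
  have IHh : `|f (x + P s h) - f x - \sum_(j <- s) fcoord j h * 'D_(fvec j) f x|
      <= e / 2 * `|h| by near: h; exact: IH.
  have := AB (_, _) (conj Ah Bh) => /= ABh.
  rewrite /P !big_cons -/(P s h) addrCA addrC.
  set z := x + P s h in Ah IHh ABh *.
  set c := fcoord i h in Bh ABh *.
  set S := \sum_(j <- s) _ in IHh *.
  have -> : f (z + c *: fvec i) - f x - (c * 'D_(fvec i) f x + S) =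
    (f (z + c *: fvec i) - f z - c * 'D_(fvec i) f x) + (f z - f x - S) by ring.
  apply: (le_trans (ler_normD _ _)); rewrite [e]splitr mulrDl.
  apply: lerD => //; apply: (le_trans ABh).
  rewrite -(mulrA (e / 2)) ler_wpM2l ?(ltW e20)//.
  by rewrite ler_pdivrMl//; exact: ck.
have dE : f \o shift x = cst (f x) + dL +o_ 0 id.
  apply/eqaddoP => e e0.
  apply: filterS (step (index_enum 'I_fdim) e e0) => h.
  rewrite /P -fcoordE -/(d h) => dh.
  rewrite [X in `|X|](_ : _ = f (x + h) - f x - d h); first exact: dh.
  by rewrite -addrA -opprD -[LHS]/(f (h + x) - (f x + d h)) [h + x]addrC.
have dc : continuous dL.
  move=> y; apply: cvg_sum => i.
  by apply: cvgM; [exact: fcoord_cont|exact: cvg_cst].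
by apply/(@diff_locallyP _ E R x f); rewrite (diff_unique dc dE).
Unshelve. all: by end_near.
Qed.
End Findim.

(** * Maps of class C^k *)
Section CkTheory.
Context {R : realType}.
Implicit Types (E F : normedModType R).

Lemma Ck_cont E F k U (f : E -> F) x : Ck k U f -> U x -> {for x, continuous f}.
Proof. by case: k => [|k] [cf _] Ux; exact: cf. Qed.

Lemma Ck_derivable E F k U (f : E -> F) x v :
  Ck k.+1 U f -> U x -> derivable f x v.
Proof. by move=> [_ /(_ v)[df _]]; exact: df. Qed.

Lemma Ck_D E F k U (f : E -> F) v : Ck k.+1 U f -> Ck k U ('D_v f).
Proof. by move=> [_ /(_ v)[]]. Qed.

Lemma Ck_pred E F k U (f : E -> F) : Ck k.+1 U f -> Ck k U f.
Proof.
elim: k f => [|k IH] f [cf df]; first by split.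
split=> // v; split; first by case: (df v).
by apply: IH; case: (df v).
Qed.

Lemma Ck_sub E F k (U V : set E) (f : E -> F) : V `<=` U -> Ck k U f -> Ck k V f.
Proof.
move=> VU; elim: k f => [|k IH] f [cf df]; (split=> [x /VU/cf//|]) => // v.
by case: (df v) => dv cv; split=> [x /VU/dv//|]; exact: IH.
Qed.

Lemma near_eq_continuous (S T : topologicalType) (f g : S -> T) x :
  {near x, f =1 g} -> {for x, continuous f} -> {for x, continuous g}.
Proof.
move=> fg cf; have : f @ x --> g x by rewrite -(nbhs_singleton fg); exact: cf.
by move=> {}cf; apply: cvg_trans cf; apply: near_eq_cvg.
Qed.

Lemma Ck_ext E F k (U : set E) (f g : E -> F) : open U ->
  (forall x, U x -> f x = g x) -> Ck k U f -> Ck k U g.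
Proof.
move=> oU; elim: k f g => [|k IH] f g fg [cf df].
  split=> // x Ux; have e : {near x, f =1 g}.
    by apply: filterS (open_nbhs_nbhs (conj oU Ux)) => y /fg.
  exact: near_eq_continuous e (cf _ Ux).
have e x : U x -> {near x, f =1 g}.
  by move=> Ux; apply: filterS (open_nbhs_nbhs (conj oU Ux)) => y /fg.
split=> [x Ux|v].
  exact: near_eq_continuous (e _ Ux) (cf _ Ux).
case: (df v) => dv cv; split=> [x Ux|].
  exact: near_eq_derivable (e _ Ux) (dv _ Ux).
by apply: IH cv => x Ux; exact: near_eq_derive (e _ Ux).
Qed.

Lemma Ck_cst E F k U (a : F) : Ck k U (cst a : E -> F).
Proof.
elim: k a => [|k IH] a; (split=> [x _|]; first exact: cvg_cst) => // v.
split=> [x _|]; first exact: derivable_cst.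
by rewrite (_ : 'D_v _ = cst 0)//; apply/funext => x; rewrite derive_cst.
Qed.

Lemma derive_linear (E F G : normedModType R) (l : {linear F -> G}) (f : E -> F) x v :
  continuous l -> derivable f x v ->
  derivable (l \o f) x v /\ 'D_v (l \o f) x = l ('D_v f x).
Proof.
move=> cl df.
have e : (fun h : R => h^-1 *: (((l \o f) \o shift x) (h *: v) - (l \o f) x)) =
    l \o (fun h : R => h^-1 *: ((f \o shift x) (h *: v) - f x)).
  by apply/funext => h /=; rewrite -linearB -linearZZ.
have cv : (l \o (fun h : R => h^-1 *: ((f \o shift x) (h *: v) - f x))) @ 0^'
    --> l ('D_v f x).
  by apply: continuous_cvg; [exact: cl|exact: df].
rewrite /derivable /derive e; split; last exact: cvg_lim cv.
by apply/cvg_ex; exists (l ('D_v f x)).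
Qed.

Lemma Ck_linear (E F G : normedModType R) k U (l : {linear F -> G}) (f : E -> F) :
  open U -> continuous l -> Ck k U f -> Ck k U (l \o f).
Proof.
move=> oU cl; elim: k f => [|k IH] f [cf df].
  by split=> // x /cf cfx; exact: continuous_comp cfx (cl _).
split=> [x /cf cfx|v]; first exact: continuous_comp cfx (cl _).
case: (df v) => dv cv; split=> [x /dv /(derive_linear cl)[]//|].
apply: (Ck_ext oU _ (IH _ cv)) => x /dv /(derive_linear cl)[_ ->] //.
Qed.

Lemma Ck_add E F k U (f g : E -> F) : open U ->
  Ck k U f -> Ck k U g -> Ck k U (f \+ g).
Proof.
move=> oU; elim: k f g => [|k IH] f g [cf df] [cg dg].
  by split=> // x Ux; apply: cvgD; [exact: cf|exact: cg].
split=> [x Ux|v]; first by apply: cvgD; [exact: cf|exact: cg].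
case: (df v) (dg v) => dfv cfv [dgv cgv]; split=> [x Ux|].
  by apply: derivableD; [exact: dfv|exact: dgv].
apply: (Ck_ext oU _ (IH _ _ cfv cgv)) => x Ux.
by rewrite -[RHS]/('D_v (f + g) x) deriveD; [|exact: dfv|exact: dgv].
Qed.

Lemma Ck_sum E F k U (J : Type) (r : seq J) (f : J -> E -> F) : open U ->
  (forall i, Ck k U (f i)) -> Ck k U (fun x => \sum_(i <- r) f i x).
Proof.
move=> oU cf; elim: r => [|i r IH].
  by apply: (Ck_ext oU _ (Ck_cst k U (0 : F))) => x _; rewrite big_nil.
by apply: (Ck_ext oU _ (Ck_add oU (cf i) IH)) => x _; rewrite big_cons.
Qed.

Lemma Ck_mul E k U (f g : E -> R) : open U ->
  Ck k U f -> Ck k U g -> Ck k U (f \* g).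
Proof.
move=> oU; elim: k f g => [|k IH] f g Cf Cg; move: (Cf) (Cg) => [cf df] [cg dg].
  by split=> // x Ux; apply: cvgM; [exact: cf|exact: cg].
split=> [x Ux|v]; first by apply: cvgM; [exact: cf|exact: cg].
case: (df v) (dg v) => dfv cfv [dgv cgv]; split=> [x Ux|].
  by apply: derivableM; [exact: dfv|exact: dgv].
apply: (Ck_ext oU _ (Ck_add oU (IH _ _ (Ck_pred Cf) cgv)
                              (IH _ _ (Ck_pred Cg) cfv))) => x Ux /=.
by rewrite -[RHS]/('D_v (f * g) x) deriveM; [|exact: dfv|exact: dgv].
Qed.

Lemma Ck_inv E k U (f : E -> R) : open U -> (forall x, U x -> f x != 0) ->
  Ck k U f -> Ck k U (fun x => (f x)^-1).
Proof.
move=> oU f0; elim: k => [|k IH] Cf; move: (Cf) => [cf df].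
  by split=> // x Ux; apply: cvgV; [exact: f0|exact: cf].
split=> [x Ux|v]; first by apply: cvgV; [exact: f0|exact: cf].
case: (df v) => dfv cfv; split=> [x Ux|].
  by apply: derivableV; [exact: f0|exact: dfv].
have Ci := IH (Ck_pred Cf).
have := Ck_mul oU (Ck_cst k U (-1 : R)) (Ck_mul oU (Ck_mul oU Ci Ci) cfv).
apply: (Ck_ext oU) => x Ux /=; rewrite deriveV; [|exact: f0|exact: dfv].
by rewrite expr2 invfM mulN1r -mulNr.
Qed.

(** Reduces maps with values in a finite-dimensional space to real functions, for
    which products are available. *)
Lemma Ck_coord E F {fF : findim F} k U (f : E -> F) : open U ->
  (forall i, Ck k U (fcoord i \o f)) -> Ck k U f.
Proof.
move=> oU cf.
have scl (a : F) : linear ( *:%R^~ a : R -> F).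
  by move=> c x y; rewrite scalerDl scalerA.
pose L a : {linear R -> F} :=
  HB.pack ( *:%R^~ a : R -> F) (GRing.isLinear.Build _ _ _ _ _ (scl a)).
have h i : Ck k U (L (fvec i) \o (fcoord i \o f)).
  by apply: Ck_linear (cf i) => //; exact: scalel_continuous.
by apply: (Ck_ext oU _ (Ck_sum (index_enum _) oU h)) => x _; rewrite [RHS]fcoordE.
Qed.

Lemma Ck_differentiable E F {fE : findim E} {fF : findim F} k U (f : E -> F) x :
  open U -> Ck k.+1 U f -> U x -> differentiable f x.
Proof.
move=> oU + Ux.
have nU : \forall y \near x, U y by apply: open_nbhs_nbhs; split.
have real (g : E -> R) : Ck k.+1 U g -> differentiable g x.
  move=> Cg; apply: C1_differentiable => v.
    by apply: filterS nU => y; exact: Ck_derivable Cg.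
  exact: Ck_cont (Ck_D v Cg) Ux.
move=> Cf.
have -> : f = \sum_(i < @fdim _ _ fF) (fun y => fcoord i (f y) *: fvec i).
  by apply/funext => y; rewrite fct_sumE [LHS]fcoordE.
apply: differentiable_sum => i; apply: (@differentiableZl _ _ _ (fcoord i \o f)).
by apply: real; apply: Ck_linear => //; exact: fcoord_cont.
Qed.

Lemma derive_comp (E F G : normedModType R) (f : F -> G) (g : E -> F) x v :
  differentiable g x -> differentiable f (g x) ->
  'D_v (f \o g) x = 'D_('D_v g x) f (g x).
Proof.
move=> dg df; rewrite !deriveE//; last exact: differentiable_comp.
by rewrite diff_comp.
Qed.

Lemma derive_fcoord E F {fE : findim E} (f : E -> F) x v : differentiable f x ->
  'D_v f x = \sum_i fcoord i v *: 'D_(fvec i) f x.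
Proof.
move=> df; rewrite deriveE// [v in LHS]fcoordE linear_sum.
by apply: eq_bigr => i _; rewrite linearZ deriveE.
Qed.

(** Induction on [k]: the chain rule expresses [D_v (f \o g)] through
    products of coordinates of [D_v g] with compositions [D_e f \o g], where
    [e] runs over a basis. *)
Lemma Ck_comp (E F G : normedModType R) {fE : findim E} {fF : findim F} {fG : findim G} k
    (U : set E) (V : set F) (f : F -> G) (g : E -> F) : open U -> open V ->
  (forall x, U x -> V (g x)) -> Ck k U g -> Ck k V f -> Ck k U (f \o g).
Proof.
move=> oU oV gUV.
suff real (f' : F -> R) : Ck k U g -> Ck k V f' -> Ck k U (f' \o g).
  move=> Cg Cf; apply: Ck_coord => // i.
  have Cfi : Ck k V (fcoord i \o f) by apply: Ck_linear => //; exact: fcoord_cont.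
  exact: (real _ Cg Cfi).
elim: k f' => [|k IH] f' Cg Cf.
  split=> // x Ux; apply: continuous_comp; first exact: Ck_cont Cg Ux.
  exact: Ck_cont Cf (gUV _ Ux).
have dg x : U x -> differentiable g x by exact: Ck_differentiable oU Cg.
have df x : V x -> differentiable f' x by exact: Ck_differentiable oV Cf.
split=> [x Ux|v].
  apply: continuous_comp; first exact: Ck_cont Cg Ux.
  exact: Ck_cont Cf (gUV _ Ux).
split=> [x Ux|].
  apply: diff_derivable; apply: differentiable_comp; first exact: dg.
  exact: df (gUV _ Ux).
have h (i : 'I_(@fdim _ _ fF)) : Ck k U ((fcoord i \o 'D_v g) \* ('D_(fvec i) f' \o g)).
  apply: Ck_mul => //; last exact: IH (Ck_pred Cg) (Ck_D _ Cf).
  by apply: Ck_linear => //; [exact: fcoord_cont|exact: Ck_D Cg].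
apply: (Ck_ext oU _ (Ck_sum (index_enum _) oU h)) => x Ux.
by rewrite (derive_comp v (dg _ Ux) (df _ (gUV _ Ux))) (derive_fcoord _ (df _ (gUV _ Ux))).
Qed.
End CkTheory.

(** * Symmetry of second derivatives *)
Section Schwarz.
Context {R : realType} {E : normedModType R}.

Lemma derive_translate (F : normedModType R) (f : E -> F) a y v :
  derivable f (y + a) v ->
  derivable (fun z => f (z + a)) y v /\ 'D_v (fun z => f (z + a)) y = 'D_v f (y + a).
Proof.
move=> df.
have e : (fun h : R => h^-1 *: (((fun z => f (z + a)) \o shift y) (h *: v) - f (y + a)))
   = (fun h : R => h^-1 *: ((f \o shift (y + a)) (h *: v) - f (y + a))).
  by apply/funext => h /=; rewrite addrA.
by rewrite /derivable /derive e.
Qed.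

(** Two applications of the mean value theorem, first along [v] to the increment
    of [f] along [w], then along [w] to [D_v f].  The second difference itself
    does not see the order of [v] and [w]. *)
Lemma second_difference (U : set E) (f : E -> R) x v w (e : R) : open U -> Ck 2 U f ->
  U x -> 0 < e -> \forall t \near 0^'+,
  `|f (x + t *: v + t *: w) - f (x + t *: v) - f (x + t *: w) + f x
     - t * t * 'D_w ('D_v f) x| <= e * (t * t).
Proof.
move=> oU Cf Ux e0.
have : \forall y \near x, U y /\ `|'D_w ('D_v f) x - 'D_w ('D_v f) y| <= e.
  near=> y; split; first by near: y; apply: open_nbhs_nbhs; split.
  near: y; have /cvgrPdist_le : {for x, continuous ('D_w ('D_v f))}.
    exact: Ck_cont (Ck_D w (Ck_D v Cf)) Ux.
  exact.
move=> /nbhs_ballP[r /= r0 br].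
near=> t.
have t0 : 0 < t by near: t; exact: nbhs_right_gt.
have tr : t * (`|v| + `|w|) < r.
  have : t < r / (`|v| + `|w| + 1).
    by near: t; apply: nbhs_right_lt; rewrite divr_gt0// ltr_wpDl// addr_ge0.
  rewrite ltr_pdivlMr ?ltr_wpDl ?addr_ge0//; apply: le_lt_trans.
  by rewrite ler_wpM2l ?(ltW t0)// lerDl.
have inb s s' : `|s| <= `|t| -> `|s'| <= `|t| -> ball x r (x + s *: v + s' *: w).
  move=> st st'; rewrite -ball_normE /= -addrA opprD addNKr normrN.
  apply: le_lt_trans tr; apply: (le_trans (ler_normD _ _)).
  by rewrite !normrZ mulrDr -(gtr0_norm t0) lerD// ler_wpM2r.
have t00 : `|0 : R| <= `|t| by rewrite normr0.
(* The second difference of [f] is the increment of [g] along [v]. *)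
pose g y := f (y + t *: w) - f y.
have dg s : `|s| <= `|t| -> derivable g (x + s *: v) v /\
    'D_v g (x + s *: v) = 'D_v f (x + s *: v + t *: w) - 'D_v f (x + s *: v).
  move=> st.
  have d1 : derivable f (x + s *: v + t *: w) v.
    by apply: Ck_derivable Cf _; apply: (br _ _).1; exact: inb.
  have d2 : derivable f (x + s *: v) v.
    apply: Ck_derivable Cf _; apply: (br _ _).1.
    by have := inb s 0 st t00; rewrite scale0r addr0.
  case: (derive_translate d1) => d3 d4; split; first exact: derivableB.
  by rewrite -d4 -deriveB.
have [s st gs] : exists2 s : R, `|s| <= `|t| &
   g (x + t *: v) - g x = t * 'D_v g (x + s *: v).
  by apply: MVT_line => s /dg[].
have [s' st' gs'] : exists2 s' : R, `|s'| <= `|t| &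
   'D_v f (x + s *: v + t *: w) - 'D_v f (x + s *: v) =
     t * 'D_w ('D_v f) (x + s *: v + s' *: w).
  apply: MVT_line => s' st'; apply: Ck_derivable (Ck_D v Cf) _.
  by apply: (br _ _).1; exact: inb.
have -> : f (x + t *: v + t *: w) - f (x + t *: v) - f (x + t *: w) + f x =
    t * t * 'D_w ('D_v f) (x + s *: v + s' *: w).
  rewrite -mulrA -gs' -(dg _ st).2 -gs /g; ring.
rewrite -mulrBr normrM ger0_norm ?mulr_ge0 ?(ltW t0)// mulrC.
rewrite ler_wpM2r ?mulr_ge0 ?(ltW t0)// distrC.
by case: (br _ (inb _ _ st st')).
Unshelve. all: by end_near.
Qed.

Lemma Schwarz_real (U : set E) (f : E -> R) x v w : open U -> Ck 2 U f -> U x ->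
  'D_w ('D_v f) x = 'D_v ('D_w f) x.
Proof.
move=> oU Cf Ux; apply/eqP; rewrite -subr_eq0 -normr_le0.
apply/ler_addgt0Pr => e e0; rewrite add0r distrC.
have e20 : 0 < e / 2 by rewrite divr_gt0.
have F0 : Filter (0 : R)^'+ by exact: at_right_proper_filter.
have [t [t0 [h1 h2]]] := filter_ex (filterI (nbhs_right_gt (0 : R))
  (filterI (second_difference v w oU Cf Ux e20)
           (second_difference w v oU Cf Ux e20))).
have tt0 : 0 < t * t by exact: mulr_gt0.
rewrite [x + t *: w + _]addrAC [_ - f (x + t *: w) - _]addrAC in h2.
move: h1 h2; move: (_ + f x) ('D_w _ x) ('D_v _ x) => D a b h1 h2.
rewrite -(ler_pM2r tt0) -[X in _ * X <= _](gtr0_norm tt0) -normrM.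
rewrite [e]splitr [X in _ <= X]mulrDl; rewrite distrC in h2.
apply: le_trans (lerD h1 h2); apply: le_trans (ler_normD _ _).
rewrite le_eqVlt; apply/orP; left; apply/eqP; congr (`| _ |).
by ring.
Qed.
End Schwarz.

(** * Germs of smooth maps *)
Section SmoothNear.
Context {R : realType}.
Implicit Types (E F G : normedModType R).

(** The condition that [smooth_at] imposes in a chart; working with germs avoids
    carrying open sets through compositions. *)
Definition smooth_near E F (f : E -> F) (x : E) : Prop :=
  exists2 U, open_nbhs x U & smooth_on U f.

Lemma smooth_near_near E F (f : E -> F) x :
  smooth_near f x -> \forall y \near x, smooth_near f y.
Proof.
move=> [U [oU Ux] sU]; apply: filterS (open_nbhs_nbhs (conj oU Ux)) => y Uy.
by exists U.
Qed.

Lemma smooth_near_ext E F (f g : E -> F) x :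
  {near x, f =1 g} -> smooth_near f x -> smooth_near g x.
Proof.
move=> fg [U oU sU]; move: fg; rewrite /prop_near1 /= nbhsE => -[V oV fg].
exists (U `&` V); first exact: open_nbhsI.
move=> k; apply: (@Ck_ext _ _ _ _ _ f).
- by apply: openI; [case: oU|case: oV].
- by move=> y [_ /fg].
- by apply: Ck_sub (sU k); exact: subIsetl.
Qed.

Lemma smooth_near_cont E F (f : E -> F) x :
  smooth_near f x -> {for x, continuous f}.
Proof. by move=> [U [_ Ux] /(_ 0%N)/Ck_cont]; apply. Qed.

Lemma smooth_near_D E F (f : E -> F) x v :
  smooth_near f x -> smooth_near ('D_v f) x.
Proof. by move=> [U oU sU]; exists U => // k; exact: Ck_D (sU k.+1). Qed.

Lemma smooth_near_diff E F {fE : findim E} {fF : findim F} (f : E -> F) x :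
  smooth_near f x -> differentiable f x.
Proof. by move=> [U [oU Ux] /(_ 1%N)/(Ck_differentiable oU)]; apply. Qed.

Lemma smooth_near_derivable E F (f : E -> F) x v :
  smooth_near f x -> derivable f x v.
Proof. by move=> [U [oU Ux] /(_ 1%N)/Ck_derivable]; apply. Qed.

Lemma smooth_near_cst E F (a : F) x : smooth_near (cst a : E -> F) x.
Proof. by exists setT => [|k]; [split=> //; exact: openT|exact: Ck_cst]. Qed.

Lemma smooth_near_linear E F {fE : findim E} {fF : findim F} (l : {linear E -> F}) x :
  smooth_near l x.
Proof.
exists setT => [|k]; first by split=> //; exact: openT.
elim: k => [|k IH]; (split=> [y _|]; first exact: findim_linear_cont) => // v.
have dl y : 'D_v l y = l v.
  by rewrite deriveE ?diff_lin//; try apply: linear_differentiable;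
    exact: findim_linear_cont.
split=> [y _|].
  apply: diff_derivable; apply: linear_differentiable.
  exact: findim_linear_cont.
by apply: (Ck_ext openT _ (Ck_cst k setT (l v))) => y _; rewrite dl.
Qed.

Lemma smooth_near_comp (E F G : normedModType R) {fE : findim E} {fF : findim F}
    {fG : findim G} (f : F -> G) (g : E -> F) x :
  smooth_near g x -> smooth_near f (g x) -> smooth_near (f \o g) x.
Proof.
move=> [U [oU Ux] sU] [V [oV Vx] sV].
(* [g] is continuous on [U] only, so the preimage of [V] need not be open. *)
pose W := (U `&` g @^-1` V)°.
have oW : open W by exact: open_interior.
have WU : W `<=` U by apply: subset_trans (@interior_subset _ _) _ => y [].
have WV : W `<=` g @^-1` V.
  by apply: subset_trans (@interior_subset _ _) _ => y [].
exists W.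
  split=> //; rewrite /W /interior /=; apply: filterI.
    by apply: open_nbhs_nbhs; split.
  by apply: (Ck_cont (sU 0%N) Ux); apply: open_nbhs_nbhs; split.
by move=> k; exact: (Ck_comp oW oV WV (Ck_sub WU (sU k)) (sV k)).
Qed.

Lemma smooth_near_id E {fE : findim E} x : smooth_near (id : E -> E) x.
Proof. exact: (smooth_near_linear idfun x). Qed.

Lemma smooth_near_fst E F {fE : findim E} {fF : findim F} x :
  smooth_near (fst : E * F -> E) x.
Proof.
have l : linear (fst : E * F -> E) by [].
pose L : {linear (E * F)%type -> E} :=
  HB.pack (fst : E * F -> E) (GRing.isLinear.Build _ _ _ _ _ l).
exact: (smooth_near_linear L x).
Qed.

Lemma smooth_near_snd E F {fE : findim E} {fF : findim F} x :
  smooth_near (snd : E * F -> F) x.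
Proof.
have l : linear (snd : E * F -> F) by [].
pose L : {linear (E * F)%type -> F} :=
  HB.pack (snd : E * F -> F) (GRing.isLinear.Build _ _ _ _ _ l).
exact: (smooth_near_linear L x).
Qed.

Lemma smooth_near_binary E (F G H : normedModType R) (f : E -> F) (g : E -> G) (h : E -> H) x :
  (forall k U, open U -> Ck k U f -> Ck k U g -> Ck k U h) ->
  smooth_near f x -> smooth_near g x -> smooth_near h x.
Proof.
move=> C [U oU sU] [V oV sV]; exists (U `&` V); first exact: open_nbhsI.
move=> k; apply: C; first by apply: openI; [case: oU|case: oV].
- by apply: Ck_sub (sU k); exact: subIsetl.
- by apply: Ck_sub (sV k); exact: subIsetr.
Qed.

Lemma smooth_nearD E F (f g : E -> F) x :
  smooth_near f x -> smooth_near g x -> smooth_near (fun y => f y + g y) x.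
Proof. by apply: smooth_near_binary => k U; exact: Ck_add. Qed.

Lemma smooth_nearM E (f g : E -> R) x :
  smooth_near f x -> smooth_near g x -> smooth_near (fun y => f y * g y) x.
Proof. by apply: smooth_near_binary => k U; exact: Ck_mul. Qed.

Lemma smooth_nearV E (f : E -> R) x :
  smooth_near f x -> f x != 0 -> smooth_near (fun y => (f y)^-1) x.
Proof.
move=> sf f0; have /cvgr_neq0 /(_ f0) := smooth_near_cont sf.
rewrite nbhsE => -[V oV V0]; case: sf => U oU sU.
exists (U `&` V); first exact: open_nbhsI.
move=> k; apply: Ck_inv; first by apply: openI; [case: oU|case: oV].
- by move=> y [_ /V0].
- by apply: Ck_sub (sU k); exact: subIsetl.
Qed.

Lemma smooth_near_sum E F (J : Type) (r : seq J) (f : J -> E -> F) x :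
  (forall i, smooth_near (f i) x) -> smooth_near (fun y => \sum_(i <- r) f i y) x.
Proof.
move=> sf; elim: r => [|i r IH].
  apply: (smooth_near_ext _ (smooth_near_cst (0 : F) x)).
  by near=> y; rewrite big_nil.
apply: (smooth_near_ext _ (smooth_nearD (sf i) IH)).
by near=> y; rewrite big_cons.
Unshelve. all: by end_near.
Qed.

Lemma smooth_near_prod E (J : Type) (r : seq J) (f : J -> E -> R) x :
  (forall i, smooth_near (f i) x) -> smooth_near (fun y => \prod_(i <- r) f i y) x.
Proof.
move=> sf; elim: r => [|i r IH].
  apply: (smooth_near_ext _ (smooth_near_cst (1 : R) x)).
  by near=> y; rewrite big_nil.
apply: (smooth_near_ext _ (smooth_nearM (sf i) IH)).
by near=> y; rewrite big_cons.
Unshelve. all: by end_near.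
Qed.

Lemma smooth_near_scale E F {fE : findim E} {fF : findim F} (f : E -> R) (a : F) x :
  smooth_near f x -> smooth_near (fun y => f y *: a) x.
Proof.
move=> sf.
have l : linear ( *:%R^~ a : R -> F) by move=> c u v; rewrite scalerDl scalerA.
pose L : {linear R -> F} :=
  HB.pack ( *:%R^~ a : R -> F) (GRing.isLinear.Build _ _ _ _ _ l).
exact: (smooth_near_comp sf (smooth_near_linear L (f x))).
Qed.

Lemma smooth_near_lin (E F G : normedModType R) {fE : findim E} {fF : findim F}
    {fG : findim G} (l : {linear F -> G}) (f : E -> F) x :
  smooth_near f x -> smooth_near (fun y => l (f y)) x.
Proof. by move=> sf; apply: (smooth_near_comp sf); exact: smooth_near_linear. Qed.

Lemma smooth_near_coord E F {fE : findim E} {fF : findim F} (f : E -> F) x :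
  (forall i, smooth_near (fun y => fcoord i (f y)) x) -> smooth_near f x.
Proof.
move=> sf; apply: (smooth_near_ext (f := fun y => \sum_i fcoord i (f y) *: fvec i)).
  by near=> y; rewrite -fcoordE.
by apply: smooth_near_sum => i; exact: smooth_near_scale.
Unshelve. all: by end_near.
Qed.

Lemma smooth_near_pair (E F G : normedModType R) {fE : findim E} {fF : findim F}
    {fG : findim G} (f : E -> F) (g : E -> G) x :
  smooth_near f x -> smooth_near g x -> smooth_near (fun y => (f y, g y)) x.
Proof.
move=> sf sg; apply: smooth_near_coord => i /=; rewrite /pair_coord.
by case: (fintype.split i) => j /=; exact: smooth_near_lin.
Qed.

(** A vector field applied to a smooth map: the direction varies with the
    point, so [D_(X y) f y] is expanded in the fixed basis directions. *)
Lemma smooth_near_dir E F {fE : findim E} {fF : findim F} (X : E -> E) (f : E -> F) x :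
  smooth_near X x -> smooth_near f x -> smooth_near (fun y => 'D_(X y) f y) x.
Proof.
move=> sX sf; apply: smooth_near_coord => j.
apply: (smooth_near_ext
  (f := fun y => \sum_i fcoord i (X y) * fcoord j ('D_(fvec i) f y))).
  apply: filterS (smooth_near_near sf) => y /smooth_near_diff /derive_fcoord ->.
  by rewrite linear_sum; apply: eq_bigr => i _; rewrite linearZ.
apply: smooth_near_sum => i; apply: smooth_nearM; apply: smooth_near_lin => //.
exact: smooth_near_D.
Qed.

Lemma Schwarz E F {fE : findim E} {fF : findim F} (f : E -> F) x v w :
  smooth_near f x -> 'D_w ('D_v f) x = 'D_v ('D_w f) x.
Proof.
move=> [U [oU Ux] sU].
have co i u y : U y -> 'D_u (fcoord i \o f) y = fcoord i ('D_u f y).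
  move=> Uy; apply: (derive_linear _ _).2; first exact: fcoord_cont.
  exact: Ck_derivable (sU 1%N) Uy.
have co2 i u u' : 'D_u' ('D_u (fcoord i \o f)) x = fcoord i ('D_u' ('D_u f) x).
  rewrite -(derive_linear (@fcoord_cont _ _ _ i) _).2; last first.
    exact: Ck_derivable (Ck_D u (sU 2%N)) Ux.
  apply: near_eq_derive; apply: filterS (open_nbhs_nbhs (conj oU Ux)) => y Uy.
  exact: co.
rewrite [LHS]fcoordE [RHS]fcoordE; apply: eq_bigr => i _; congr (_ *: _).
rewrite -!co2; apply: (Schwarz_real v w oU _ Ux).
by apply: Ck_linear (sU 2%N) => //; exact: fcoord_cont.
Qed.

Lemma derive_add_dir E F {fE : findim E} {fF : findim F} (f : E -> F) x u v :
  smooth_near f x -> 'D_(u + v) f x = 'D_u f x + 'D_v f x.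
Proof. by move=> /smooth_near_diff df; rewrite !deriveE// linearD. Qed.

Lemma derive_linear_dir E F {fE : findim E} {fF : findim F} (f : E -> F) x :
  smooth_near f x -> linear (fun v => 'D_v f x).
Proof. by move=> /smooth_near_diff df a u v; rewrite !deriveE// linearP. Qed.

Lemma smooth_near_chain (E F G : normedModType R) {fE : findim E}
    {fF : findim F} {fG : findim G} (f : F -> G) (g : E -> F) x v :
  smooth_near g x -> smooth_near f (g x) ->
  'D_v (f \o g) x = 'D_('D_v g x) f (g x).
Proof.
by move=> sg sf; apply: derive_comp; exact: smooth_near_diff.
Qed.

End SmoothNear.

(** * Derivatives of maps on products *)
Section DeriveMore.
Context {R : realType}.

Lemma derive_fst (E F G : normedModType R) (f : E * F -> G) x y u :
  'D_(u, 0) f (x, y) = 'D_u (fun z => f (z, y)) x.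
Proof.
have e : (fun h : R => h^-1 *: ((f \o shift (x, y)) (h *: (u, 0)) - f (x, y))) =
    (fun h : R => h^-1 *: (((fun z => f (z, y)) \o shift x) (h *: u) - f (x, y))).
  apply/funext => h /=.
  by rewrite -[h *: _ + _]/(h *: u + x, h *: 0 + y) scaler0 add0r.
by rewrite /derive e.
Qed.

Lemma derive_snd (E F G : normedModType R) (f : E * F -> G) x y u :
  'D_(0, u) f (x, y) = 'D_u (fun z => f (x, z)) y.
Proof.
have e : (fun h : R => h^-1 *: ((f \o shift (x, y)) (h *: (0, u)) - f (x, y))) =
    (fun h : R => h^-1 *: (((fun z => f (x, z)) \o shift y) (h *: u) - f (x, y))).
  apply/funext => h /=.
  by rewrite -[h *: _ + _]/(h *: 0 + x, h *: u + y) scaler0 add0r.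
by rewrite /derive e.
Qed.

Lemma smooth_near_partial_snd (E F G : normedModType R) {fE : findim E} {fF : findim F}
   {fG : findim G} (f : E * F -> G) x y :
  smooth_near f (x, y) -> smooth_near (fun z => f (x, z)) y.
Proof.
move=> sf; apply: (smooth_near_comp (g := fun z => (x, z))) => //.
by apply: smooth_near_pair; [exact: smooth_near_cst|exact: smooth_near_id].
Qed.

Lemma derive_pair (E F G : normedModType R) {fE : findim E} {fF : findim F}
   {fG : findim G} (f : E -> F) (g : E -> G) x u :
  smooth_near f x -> smooth_near g x ->
  'D_u (fun z => (f z, g z)) x = ('D_u f x, 'D_u g x).
Proof.
move=> /smooth_near_diff df /smooth_near_diff dg.
by rewrite !deriveE//; [rewrite diff_pair|exact: differentiable_pair].
Qed.

Lemma smooth_near_dir2 (E F : normedModType R) {fE : findim E} {fF : findim F}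
   (f : E -> F) x v : smooth_near f x ->
  smooth_near (fun z : E * E => 'D_(z.2) f z.1) (x, v).
Proof.
move=> sf.
have sff : smooth_near (f \o fst : E * E -> F) (x, v).
  by apply: smooth_near_comp => //; exact: smooth_near_fst.
have sX : smooth_near (fun z : E * E => (z.2, 0 : E)) (x, v).
  by apply: smooth_near_pair; [exact: smooth_near_snd|exact: smooth_near_cst].
have -> : (fun z : E * E => 'D_(z.2) f z.1) = (fun z => 'D_(z.2, 0) (f \o fst) z).
  by apply/funext => -[a b]; rewrite derive_fst.
exact: smooth_near_dir.
Qed.

(** Differentiating a derivative whose direction and base point both move.  It is
    the chain rule for [(y, v) |-> D_v f y], which is linear in [v]. *)
Lemma derive_dir (E F G : normedModType R) {fE : findim E} {fF : findim F}
   {fG : findim G} (f : E -> F) (c eta : G -> E) x u :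
  smooth_near c x -> smooth_near eta x -> smooth_near f (c x) ->
  'D_u (fun z => 'D_(eta z) f (c z)) x =
    'D_('D_u eta x) f (c x) + 'D_('D_u c x) ('D_(eta x) f) (c x).
Proof.
move=> sc se sf.
(* As a map of two variables, [Psi] is smooth and linear in the second one. *)
pose Psi (z : E * E) := 'D_(z.2) f z.1.
have sPsi : smooth_near Psi (c x, eta x) by exact: smooth_near_dir2.
have sce : smooth_near (fun z => (c z, eta z)) x by exact: smooth_near_pair.
rewrite -[LHS]/('D_u (Psi \o (fun z => (c z, eta z))) x).
rewrite (smooth_near_chain _ sce sPsi) (derive_pair _ sc se).
have -> : ('D_u c x, 'D_u eta x) = (0, 'D_u eta x) + ('D_u c x, 0).
  by apply: injective_projections; rewrite /= ?addr0 ?add0r.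
rewrite (derive_add_dir _ _ sPsi) derive_fst derive_snd /Psi /=; congr (_ + _).
have l : linear (fun v => 'D_v f (c x)) by exact: derive_linear_dir.
pose L : {linear E -> F} :=
  HB.pack (fun v => 'D_v f (c x)) (GRing.isLinear.Build _ _ _ _ _ l).
have Lc : continuous L by exact: findim_linear_cont.
rewrite -[LHS]/('D_('D_u eta x) L (eta x)) deriveE ?diff_lin//.
exact: linear_differentiable.
Qed.

Lemma smooth_near_scalev (E F : normedModType R) {fE : findim E} {fF : findim F}
   (f : E -> R) (g : E -> F) x :
  smooth_near f x -> smooth_near g x -> smooth_near (fun y => f y *: g y) x.
Proof.
move=> sf sg; apply: smooth_near_coord => i.
apply: (smooth_near_ext (f := fun y => f y * fcoord i (g y))).
  by near=> y; rewrite linearZ.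
by apply: smooth_nearM => //; exact: smooth_near_lin.
Unshelve. all: by end_near.
Qed.

Lemma smooth_nearN (E F : normedModType R) {fE : findim E} {fF : findim F}
   (f : E -> F) x : smooth_near f x -> smooth_near (fun y => - f y) x.
Proof.
move=> sf; apply: (smooth_near_ext (f := fun y => -1 *: f y)).
  by near=> y; rewrite scaleN1r.
by apply: smooth_near_scalev => //; exact: smooth_near_cst.
Unshelve. all: by end_near.
Qed.

End DeriveMore.

(** * Smooth atlases *)

(** The local form of the atlas axioms: neighbourhoods and germs at a point
    instead of open images and smoothness on sets.  In this form they pass
    directly to products and to compositions of charts. *)
Record smooth_atlas {R : realType} {E : normedModType R} {M : topologicalType}
    (A : atlas E M) : Prop := SmoothAtlas {
  sa_dom : forall p, dom A p p;
  sa_open : forall p q, dom A p q -> \forall r \near q, dom A p r;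
  sa_img : forall p q, dom A p q -> \forall x \near chart A p q,
    dom A p (chart_inv A p x) /\ chart A p (chart_inv A p x) = x;
  sa_K : forall p q, dom A p q -> chart_inv A p (chart A p q) = q;
  sa_cont : forall p q, dom A p q -> {for q, continuous (chart A p)};
  sa_cont_inv : forall p q, dom A p q ->
    {for chart A p q, continuous (chart_inv A p)};
  sa_trans : forall p q r, dom A p q -> dom A r q ->
    smooth_near (chart A r \o chart_inv A p) (chart A p q) }.

Section Atlases.
Context {R : realType}.

Lemma manifold_atlas (E : normedModType R) (M : topologicalType) (A : atlas E M) :
  is_manifold A -> smooth_atlas A.
Proof.
move=> [_ _ cA contA trA].
have img p q : dom A p q -> \forall x \near chart A p q,
    dom A p (chart_inv A p x) /\ chart A p (chart_inv A p x) = x.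
  move=> pq; case: (cA p) => _ _ oimg K.
  have : nbhs (chart A p q) (chart A p @` dom A p).
    by apply: open_nbhs_nbhs; split=> //; exists q.
  by apply: filterS => _ [r pr <-]; rewrite K.
have od p q : dom A p q -> \forall r \near q, dom A p r.
  by move=> pq; apply: open_nbhs_nbhs; split=> //; case: (cA p).
have KA p q : dom A p q -> chart_inv A p (chart A p q) = q.
  by case: (cA p) => _ _ _; apply.
split=> //.
- by move=> p; case: (cA p).
- by move=> p q /contA[].
- by move=> p q /contA[].
move=> p q r pq rq.
have : nbhs (chart A p q) (chart A p @` (dom A p `&` dom A r)).
  have n1 := img _ _ pq.
  have n2 : \forall x \near chart A p q, dom A r (chart_inv A p x).
    have [_ c] := contA _ _ pq; apply: c; rewrite KA//.
    exact: od.
  by apply: filterS2 n1 n2 => x [h1 h2] h3; exists (chart_inv A p x).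
rewrite nbhsE => -[V oV Vs]; exists V => // k.
exact: Ck_sub Vs (trA p r k).
Qed.

Lemma vector_smooth_atlas (E : normedModType R) {fE : findim E} :
  smooth_atlas (vector_atlas E).
Proof.
split=> //=.
- by move=> p q _; near=> r.
- by move=> p q _; near=> r.
- by move=> p q _; exact: cvg_id.
- by move=> p q _; exact: cvg_id.
- by move=> p q _ _ _; exact: smooth_near_id.
Unshelve. all: by end_near.
Qed.

Lemma prod_smooth_atlas (E F : normedModType R) {fE : findim E} {fF : findim F}
    (M N : topologicalType) (A : atlas E M) (B : atlas F N) :
  smooth_atlas A -> smooth_atlas B ->
  smooth_atlas (prod_atlas A B : atlas (E * F)%type (M * N)%type).
Proof.
move=> sA sB; split.
- by move=> p; split; exact: sa_dom.
- move=> p q [/= pq pq'].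
  exists (dom A p.1, dom B p.2) => //.
  by split; exact: sa_open.
- move=> p q [/= pq pq'].
  exists ([set x | dom A p.1 (chart_inv A p.1 x) /\ chart A p.1 (chart_inv A p.1 x) = x],
          [set x | dom B p.2 (chart_inv B p.2 x) /\ chart B p.2 (chart_inv B p.2 x) = x]).
    by split; exact: sa_img.
  by move=> [x y] /= [[? ex] [? ey]]; split; [split|rewrite ex ey].
- by move=> p [q q'] [/= pq pq']; rewrite !sa_K.
- move=> p [q q'] [/= pq pq']; apply: cvg_pair => /=.
    by apply: (cvg_comp fst (chart A p.1) _ (sa_cont sA pq)); exact: cvg_fst.
  by apply: (cvg_comp snd (chart B p.2) _ (sa_cont sB pq')); exact: cvg_snd.
- move=> p [q q'] [/= pq pq']; apply: cvg_pair => /=.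
    by apply: (cvg_comp fst (chart_inv A p.1) _ (sa_cont_inv sA pq)); exact: cvg_fst.
  by apply: (cvg_comp snd (chart_inv B p.2) _ (sa_cont_inv sB pq')); exact: cvg_snd.
- move=> p [q q'] r [/= pq pq'] [/= rq rq']; apply: smooth_near_pair.
    exact: (smooth_near_comp (smooth_near_fst (chart A p.1 q, chart B p.2 q'))
              (sa_trans sA pq rq)).
  exact: (smooth_near_comp (smooth_near_snd (chart A p.1 q, chart B p.2 q'))
            (sa_trans sB pq' rq')).
Qed.
End Atlases.

(** * Functions and vector fields on a manifold *)
Section ManifoldCalculus.
Context {R : realType} {E : normedModType R} {fE : findim E} {M : topologicalType}
  (A : atlas E M) (sA : smooth_atlas A).
Implicit Types (p q : M) (F : normedModType R).

Lemma near_chart_inv p q (P : M -> Prop) : dom A p q ->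
  (\forall r \near q, P r) -> \forall x \near chart A p q, P (chart_inv A p x).
Proof.
move=> pq nP; have := sa_cont_inv sA pq; apply.
by rewrite (sa_K sA pq).
Qed.

Lemma smooth_near_chart F {fF : findim F} (f : M -> F) p q : dom A p q ->
  smooth_at A f q -> smooth_near (f \o chart_inv A p) (chart A p q).
Proof.
move=> pq sf; have qq := sa_dom sA q.
have st := sa_trans sA pq qq.
apply: (smooth_near_ext (f := (f \o chart_inv A q) \o (chart A q \o chart_inv A p))).
  have := near_chart_inv pq (sa_open sA qq).
  by apply: filterS => x; rewrite /= => /(sa_K sA) ->.
apply: smooth_near_comp st _; rewrite /= (sa_K sA pq); exact: sf.
Qed.

Lemma smooth_atP F {fF : findim F} (f : M -> F) p q : dom A p q ->
  smooth_near (f \o chart_inv A p) (chart A p q) -> smooth_at A f q.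
Proof.
move=> pq sf; have qq := sa_dom sA q.
have st := sa_trans sA qq pq.
apply: (smooth_near_ext (f := (f \o chart_inv A p) \o (chart A p \o chart_inv A q))).
  have := near_chart_inv qq (sa_open sA pq).
  by apply: filterS => x; rewrite /= => /(sa_K sA) ->.
apply: smooth_near_comp st _; rewrite /= (sa_K sA qq); exact: sf.
Qed.

Lemma near_chart p q (P : E -> Prop) : dom A p q ->
  (\forall x \near chart A p q, P x) -> \forall r \near q, P (chart A p r).
Proof. by move=> pq nP; have := sa_cont sA pq; apply. Qed.

Lemma smooth_at_near F {fF : findim F} (f : M -> F) p :
  smooth_at A f p -> \forall q \near p, smooth_at A f q.
Proof.
move=> sf; have pp := sa_dom sA p.
have n1 := near_chart pp (smooth_near_near sf).
by apply: filterS2 (sa_open sA pp) n1 => q; exact: smooth_atP.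
Qed.

Lemma smooth_at_ext F {fF : findim F} (f g : M -> F) p :
  {near p, f =1 g} -> smooth_at A f p -> smooth_at A g p.
Proof.
move=> fg; apply: smooth_near_ext; exact: (near_chart_inv (sa_dom sA p) fg).
Qed.

Lemma tder_ext F (f g : M -> F) p v :
  {near p, f =1 g} -> tder A p v f = tder A p v g.
Proof.
move=> fg; apply: near_eq_derive; exact: (near_chart_inv (sa_dom sA p) fg).
Qed.

Lemma smooth_at_chart p q : dom A p q -> smooth_at A (chart A p) q.
Proof.
by move=> pq; apply: (sa_trans sA (sa_dom sA q)).
Qed.

(** Derivations at [q] are defined in the preferred chart at [q]; to let [q] vary
    they have to be expressed in one fixed chart. *)
Lemma tder_chart F {fF : findim F} (f : M -> F) p q v : dom A p q ->
  smooth_at A f q ->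
  tder A q v f = 'D_(tder A q v (chart A p)) (f \o chart_inv A p) (chart A p q).
Proof.
move=> pq sf; have qq := sa_dom sA q.
have st : smooth_near (chart A p \o chart_inv A q) (chart A q q) := sa_trans sA qq pq.
have sfp : smooth_near (f \o chart_inv A p) (chart A p q).
  exact: smooth_near_chart.
have e : (chart A p \o chart_inv A q) (chart A q q) = chart A p q.
  by rewrite /= (sa_K sA qq).
rewrite /tder -[in X in _ = X]e -smooth_near_chain ?e//.
apply: near_eq_derive.
have := near_chart_inv qq (sa_open sA pq).
by apply: filterS => x; rewrite /= => /(sa_K sA) ->.
Qed.

Lemma tder_id p v : tder A p v (chart A p) = v.
Proof.
rewrite /tder -[RHS](derive_id (chart A p p)); apply: near_eq_derive.
by apply: filterS (sa_img sA (sa_dom sA p)) => x [].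
Qed.

Lemma tder_linear F {fF : findim F} (f : M -> F) p : smooth_at A f p ->
  linear (fun v => tder A p v f).
Proof. exact: derive_linear_dir. Qed.

Lemma smooth_at_tder F {fF : findim F} (f : M -> F) (X : M -> E) p :
  smooth_vfield A X -> smooth_at A f p -> smooth_at A (fun q => tder A q (X q) f) p.
Proof.
move=> sX sf; have pp := sa_dom sA p.
apply: (smooth_near_ext (f := fun x =>
   'D_(((fun q => tder A q (X q) (chart A p)) \o chart_inv A p) x) (f \o chart_inv A p) x)).
  apply: filterS2 (sa_img sA pp) (near_chart_inv pp (smooth_at_near sf)).
  move=> x [px cx] sfx.
  by rewrite /= (tder_chart _ px sfx) cx.
by apply: smooth_near_dir; [exact: sX|exact: sf].
Qed.

(** In the chart at [p], [v(X f)] splits into the derivative of [f] along the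
    derivative of the components of [X], and a second derivative of [f].  The
    latter is symmetric, so it drops out of the commutator. *)
Lemma tder_tder F {fF : findim F} (f : M -> F) (X : M -> E) p v :
  smooth_vfield A X -> smooth_at A f p ->
  tder A p v (fun q => tder A q (X q) f) =
    tder A p (tder A p v (fun q => tder A q (X q) (chart A p))) f
    + 'D_v ('D_(X p) (f \o chart_inv A p)) (chart A p p).
Proof.
move=> sX sf; have pp := sa_dom sA p.
pose xi := (fun q => tder A q (X q) (chart A p)) \o chart_inv A p.
have e : tder A p v (fun q => tder A q (X q) f) =
    'D_v (fun x => 'D_(xi x) (f \o chart_inv A p) (id x)) (chart A p p).
  apply: near_eq_derive.
  apply: filterS2 (sa_img sA pp) (near_chart_inv pp (smooth_at_near sf)).
  move=> x [px cx] sfx.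
  by rewrite /= (tder_chart _ px sfx) cx.
have sxi : smooth_near xi (chart A p p) by exact: sX.
have xip : xi (chart A p p) = X p by rewrite /xi /= (sa_K sA pp) tder_id.
rewrite e derive_dir ?derive_id ?xip//; last exact: smooth_near_id.
Qed.

Lemma tder_vbracket F {fF : findim F} (f : M -> F) (X Y : M -> E) p :
  smooth_vfield A X -> smooth_vfield A Y -> smooth_at A f p ->
  tder A p (vbracket A X Y p) f =
  tder A p (X p) (fun q => tder A q (Y q) f) - tder A p (Y p) (fun q => tder A q (X q) f).
Proof.
move=> sX sY sf; rewrite (tder_tder _ sX sf) (tder_tder _ sY sf).
rewrite (Schwarz (X p) (Y p) sf).
have aux (a b c : F) : (a + c) - (b + c) = a - b.
  by rewrite opprD addrACA subrr addr0.
rewrite aux.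
have l : linear (fun v => tder A p v f) by exact: tder_linear.
pose L : {linear E -> F} :=
  HB.pack (fun v => tder A p v f) (GRing.isLinear.Build _ _ _ _ _ l).
exact: (linearB L).
Qed.

(** Identities between tangent vectors can be tested on real functions, where the
    product rule and ring computations are available. *)
Lemma vector_tder p v w : (forall i, tder A p v (fun q => fcoord i (chart A p q)) =
   tder A p w (fun q => fcoord i (chart A p q))) -> v = w.
Proof.
move=> H; rewrite [v]fcoordE [w]fcoordE; apply: eq_bigr => i _; congr (_ *: _).
have e u : tder A p u (fun q => fcoord i (chart A p q)) = fcoord i u.
  rewrite -[in RHS](tder_id p u) /tder.
  have h : derivable (chart A p \o chart_inv A p) (chart A p p) u.
    apply: smooth_near_derivable; exact: (smooth_at_chart (sa_dom sA p)).
  exact: (derive_linear (@fcoord_cont _ _ _ i) h).2.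
by rewrite -!e.
Qed.

Lemma smooth_vbracket (X Y : M -> E) :
  smooth_vfield A X -> smooth_vfield A Y -> smooth_vfield A (vbracket A X Y).
Proof.
move=> sX sY p; have pp := sa_dom sA p.
apply: (smooth_at_ext (f := fun q => tder A q (X q) (fun r => tder A r (Y r) (chart A p))
   - tder A q (Y q) (fun r => tder A r (X r) (chart A p)))).
  apply: filterS (sa_open sA pp) => q pq.
  by rewrite (tder_vbracket sX sY (smooth_at_chart pq)).
apply: smooth_nearD; last apply: smooth_nearN.
  by apply: (smooth_at_tder sX); exact: sY.
by apply: (smooth_at_tder sY); exact: sX.
Qed.

Section TderAlgebra.
Variables (p : M).

Lemma tderD F {fF : findim F} (f g : M -> F) v : smooth_at A f p -> smooth_at A g p ->
  tder A p v (fun q => f q + g q) = tder A p v f + tder A p v g.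
Proof.
move=> sf sg; rewrite /tder -deriveD; last exact: smooth_near_derivable.
  by [].
exact: smooth_near_derivable.
Qed.

Lemma tderN F {fF : findim F} (f : M -> F) v : smooth_at A f p ->
  tder A p v (fun q => - f q) = - tder A p v f.
Proof.
by move=> sf; rewrite /tder -deriveN; last exact: smooth_near_derivable.
Qed.

Lemma tderB F {fF : findim F} (f g : M -> F) v : smooth_at A f p -> smooth_at A g p ->
  tder A p v (fun q => f q - g q) = tder A p v f - tder A p v g.
Proof.
move=> sf sg; rewrite /tder -deriveB; last exact: smooth_near_derivable.
  by [].
exact: smooth_near_derivable.
Qed.

Lemma tderM (f g : M -> R) v : smooth_at A f p -> smooth_at A g p ->
  tder A p v (fun q => f q * g q) = f p * tder A p v g + g p * tder A p v f.
Proof.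
move=> sf sg; rewrite /tder.
rewrite -[LHS]/('D_v ((f \o chart_inv A p) * (g \o chart_inv A p)) (chart A p p)).
rewrite deriveM; [|exact: smooth_near_derivable..].
by rewrite /= (sa_K sA (sa_dom sA p)).
Qed.

Lemma tder_cst F {fF : findim F} (a : F) v : tder A p v (fun _ => a) = 0.
Proof. by rewrite /tder -[LHS]/('D_v (cst a) (chart A p p)) derive_cst. Qed.

Lemma tderDv F {fF : findim F} (f : M -> F) u v : smooth_at A f p ->
  tder A p (u + v) f = tder A p u f + tder A p v f.
Proof. by move=> sf; rewrite -[u in LHS]scale1r (tder_linear sf) scale1r. Qed.

Lemma tderZv F {fF : findim F} (f : M -> F) a u : smooth_at A f p ->
  tder A p (a *: u) f = a *: tder A p u f.
Proof.
move=> sf; rewrite -[a *: u]addr0 (tder_linear sf).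
by rewrite [X in _ + X]derive0 addr0.
Qed.

Lemma tderNv F {fF : findim F} (f : M -> F) u : smooth_at A f p ->
  tder A p (- u) f = - tder A p u f.
Proof. by move=> sf; rewrite -scaleN1r tderZv// scaleN1r. Qed.
End TderAlgebra.
End ManifoldCalculus.

(** * Exterior derivatives on vector fields *)
Section Forms.
Context {R : realType} {E : normedModType R} {fE : findim E} {M : topologicalType}
  (A : atlas E M) (sA : smooth_atlas A).
Implicit Types (p q : M) (X Y Z : M -> E).

Let coord_at p i q := fcoord i (chart A p q).

Lemma smooth_coord_at p i : smooth_at A (coord_at p i) p.
Proof.
have s : smooth_at A (chart A p) p by apply: smooth_at_chart => //; exact: sa_dom.
exact: (smooth_near_lin (fcoord i) s).
Qed.

Lemma tder0 (F : normedModType R) (f : M -> F) p : tder A p 0 f = 0.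
Proof. exact: derive0. Qed.

Lemma vbracketN X Y p : vbracket A Y X p = - vbracket A X Y p.
Proof. by rewrite /vbracket opprB. Qed.

Lemma tder_vbracket2 (f : M -> R) X Y p v :
  smooth_vfield A X -> smooth_vfield A Y -> smooth_at A f p ->
  tder A p v (fun q => tder A q (vbracket A X Y q) f) =
  tder A p v (fun q => tder A q (X q) (fun r => tder A r (Y r) f))
  - tder A p v (fun q => tder A q (Y q) (fun r => tder A r (X r) f)).
Proof.
move=> sX sY sf; rewrite -tderB//; last 2 first.
- by do 2 apply: smooth_at_tder => //.
- by do 2 apply: smooth_at_tder => //.
apply: tder_ext => //; apply: filterS (smooth_at_near sA sf) => q sfq.
by rewrite tder_vbracket.
Qed.

Let tder3 f X Y Z p : R :=
  tder A p (X p) (fun q => tder A q (Y q) (fun r => tder A r (Z r) f)).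

Lemma tder_vbracket3 (f : M -> R) X Y Z p :
  smooth_vfield A X -> smooth_vfield A Y -> smooth_vfield A Z -> smooth_at A f p ->
  tder A p (vbracket A (vbracket A X Y) Z p) f =
    tder3 f X Y Z p - tder3 f Y X Z p - (tder3 f Z X Y p - tder3 f Z Y X p).
Proof.
move=> sX sY sZ sf.
apply: (eq_trans (tder_vbracket sA (smooth_vbracket sA sX sY) sZ sf)).
congr (_ - _); last exact: tder_vbracket2.
by apply: tder_vbracket => //; exact: smooth_at_tder.
Qed.

(** Applied to a coordinate function, each double bracket becomes four third-order
    derivatives, and the twelve terms cancel. *)
Lemma vbracket_jacobi X Y Z p :
  smooth_vfield A X -> smooth_vfield A Y -> smooth_vfield A Z ->
  vbracket A (vbracket A X Y) Z p - vbracket A (vbracket A X Z) Y p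
    + vbracket A (vbracket A Y Z) X p = 0.
Proof.
move=> sX sY sZ; apply: (vector_tder sA (p := p)) => i.
have sf := smooth_coord_at p i; rewrite -/(coord_at p i).
have e3 (u v w : E) : tder A p (u - v + w) (coord_at p i) =
    tder A p u (coord_at p i) - tder A p v (coord_at p i) + tder A p w (coord_at p i).
  by rewrite tderDv// tderDv// tderNv.
apply: (eq_trans (e3 _ _ _)); apply: esym; apply: (eq_trans (tder0 _ _)).
have lin3 (a b c a' b' c' : R) : a = a' -> b = b' -> c = c' ->
  0 = a' - b' + c' -> 0 = a - b + c by move=> -> -> ->.
apply: (lin3 _ _ _ _ _ _ (tder_vbracket3 sX sY sZ sf) (tder_vbracket3 sX sZ sY sf)
  (tder_vbracket3 sY sZ sX sf)).
move: (tder3 (coord_at p i)) => D; ring.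
Qed.

Variables (al : M -> E -> R).
Hypotheses (al_lin : forall q, linear (al q : E -> R))
  (al_smooth : forall X p, smooth_vfield A X -> smooth_at A (fun q => al q (X q) : R) p).

Let alL q : {linear E -> R} :=
  HB.pack (al q : E -> R) (GRing.isLinear.Build _ _ _ _ _ (al_lin q)).
Let alB q u v : al q (u - v) = al q u - al q v. Proof. exact: (linearB (alL q)). Qed.
Let alD q u v : al q (u + v) = al q u + al q v. Proof. exact: (linearD (alL q)). Qed.
Let alZ q a v : al q (a *: v) = a * al q v. Proof. exact: (linearZZ (alL q)). Qed.
Let al0 q : al q 0 = 0. Proof. exact: (linear0 (alL q)). Qed.

Lemma tder_d1 X Y p v : smooth_vfield A X -> smooth_vfield A Y ->
  tder A p v (fun q => - d1 A al X Y q) =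
   - tder A p v (fun q => tder A q (X q) (fun r => al r (Y r) : R))
   + tder A p v (fun q => tder A q (Y q) (fun r => al r (X r) : R))
   + tder A p v (fun q => al q (vbracket A X Y q) : R).
Proof.
move=> sX sY.
have s1 : smooth_at A (fun q => tder A q (X q) (fun r => al r (Y r) : R)) p.
  by apply: smooth_at_tder => //; exact: al_smooth.
have s2 : smooth_at A (fun q => tder A q (Y q) (fun r => al r (X r) : R)) p.
  by apply: smooth_at_tder => //; exact: al_smooth.
have s3 : smooth_at A (fun q => al q (vbracket A X Y q) : R) p.
  by apply: al_smooth; exact: smooth_vbracket.
have s12 : smooth_at A (fun q => tder A q (X q) (fun r => al r (Y r) : R) -
    tder A q (Y q) (fun r => al r (X r) : R)) p.
  by apply: smooth_nearD => //; exact: smooth_nearN.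
have s123 : smooth_at A (fun q => d1 A al X Y q) p.
  by apply: smooth_nearD => //; exact: smooth_nearN.
apply: (eq_trans (tderN _ s123)).
apply: (eq_trans (congr1 -%R (tderB _ s12 s3))).
apply: (eq_trans (congr1 (fun t => - (t - _)) (tderB _ s1 s2))).
have aux (a b c : R) : - (a - b - c) = - a + b + c by ring.
exact: aux.
Qed.

(** [d d = 0], stated for a 2-form [w] that is only known to take the values of
    [- d al] on vector fields: this is how the Kaehler form is obtained.  After
    expansion every second-order term cancels by [[X,Y] f = X Y f - Y X f] and
    what remains is [al] of the Jacobi identity. *)
Lemma d2_d1 (w : M -> E -> E -> R) X Y Z p :
  (forall U V q, smooth_vfield A U -> smooth_vfield A V ->
     w q (U q) (V q) = - d1 A al U V q) ->
  smooth_vfield A X -> smooth_vfield A Y -> smooth_vfield A Z ->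
  d2 A w X Y Z p = 0.
Proof.
move=> wE sX sY sZ.
have wf U V : smooth_vfield A U -> smooth_vfield A V ->
    (fun q => w q (U q) (V q) : R) = (fun q => - d1 A al U V q).
  by move=> sU sV; apply/funext => q; exact: wE.
have vb U V W : smooth_vfield A U -> smooth_vfield A V -> smooth_vfield A W ->
    tder A p (vbracket A U V p) (fun q => al q (W q) : R) =
      tder A p (U p) (fun q => tder A q (V q) (fun r => al r (W r) : R)) -
      tder A p (V p) (fun q => tder A q (U q) (fun r => al r (W r) : R)).
  by move=> sU sV sW; apply: tder_vbracket => //; exact: al_smooth.
pose proof (eq_trans (congr1 (tder A p (X p)) (wf _ _ sY sZ)) (tder_d1 _ _ sY sZ)) as e1.
pose proof (eq_trans (congr1 (tder A p (Y p)) (wf _ _ sX sZ)) (tder_d1 _ _ sX sZ)) as e2.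
pose proof (eq_trans (congr1 (tder A p (Z p)) (wf _ _ sX sY)) (tder_d1 _ _ sX sY)) as e3.
have wE' U V W : smooth_vfield A U -> smooth_vfield A V -> smooth_vfield A W ->
    w p (vbracket A U V p) (W p) = - (
      tder A p (U p) (fun q => tder A q (V q) (fun r => al r (W r) : R)) -
      tder A p (V p) (fun q => tder A q (U q) (fun r => al r (W r) : R)) -
      tder A p (W p) (fun q => al q (vbracket A U V q) : R) -
      al p (vbracket A (vbracket A U V) W p)).
  move=> sU sV sW.
  apply: (eq_trans (wE _ _ p (smooth_vbracket sA sU sV) sW)).
  exact: (congr1 (fun t => - (t - _ - _)) (vb _ _ _ sU sV sW)).
have J : al p (vbracket A (vbracket A X Y) Z p) - al p (vbracket A (vbracket A X Z) Y p)
    + al p (vbracket A (vbracket A Y Z) X p) = 0.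
  by rewrite -alB -alD vbracket_jacobi// al0.
have aux (t1 t2 t3 w1 w2 w3 xyz xzy yxz yzx zxy zyx x y z j1 j2 j3 : R) :
  t1 = - xyz + xzy + x -> t2 = - yxz + yzx + y -> t3 = - zxy + zyx + z ->
  w1 = - (xyz - yxz - z - j1) -> w2 = - (xzy - zxy - y - j2) ->
  w3 = - (yzx - zyx - x - j3) -> j1 - j2 + j3 = 0 ->
  t1 - t2 + t3 - w1 + w2 - w3 = 0.
  by move=> -> -> -> -> -> -> J0; rewrite -[RHS]oppr0 -[X in _ = - X]J0; ring.
exact: (aux _ _ _ _ _ _ _ _ _ _ _ _ _ _ _ _ _ _ e1 e2 e3
  (wE' _ _ _ sX sY sZ) (wE' _ _ _ sX sZ sY) (wE' _ _ _ sY sZ sX) J).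
Qed.

Lemma d1_anti X Y p : d1 A al X Y p = - d1 A al Y X p.
Proof.
have e : al p (vbracket A Y X p) = - al p (vbracket A X Y p).
  by rewrite vbracketN; exact: (linearN (alL p)).
have aux (a b c c' : R) : c' = - c -> a - b - c = - (b - a - c').
  by move=> ->; ring.
exact: aux.
Qed.

Lemma smooth_vfieldD X Y : smooth_vfield A X -> smooth_vfield A Y ->
  smooth_vfield A (fun q => X q + Y q).
Proof.
move=> sX sY p.
apply: (smooth_at_ext sA (f := fun q => tder A q (X q) (chart A p) + tder A q (Y q) (chart A p))).
  apply: filterS (sa_open sA (sa_dom sA p)) => q pq.
  by rewrite tderDv//; exact: smooth_at_chart.
by apply: smooth_nearD; [exact: sX|exact: sY].
Qed.

Lemma smooth_vfieldZ (a : M -> R) X : (forall p, smooth_at A a p) ->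
  smooth_vfield A X -> smooth_vfield A (fun q => a q *: X q).
Proof.
move=> sa sX p.
apply: (smooth_at_ext sA (f := fun q => a q *: tder A q (X q) (chart A p))).
  apply: filterS (sa_open sA (sa_dom sA p)) => q pq.
  by rewrite tderZv//; exact: smooth_at_chart.
by apply: smooth_near_scalev; [exact: sa|exact: sX].
Qed.

Lemma vbracketD X X' Y p : smooth_vfield A X -> smooth_vfield A X' -> smooth_vfield A Y ->
  vbracket A (fun q => X q + X' q) Y p = vbracket A X Y p + vbracket A X' Y p.
Proof.
move=> sX sX' sY; have sXX' := smooth_vfieldD sX sX'.
apply: (vector_tder sA (p := p)) => i; have sf := smooth_coord_at p i; rewrite -/(coord_at p i).
have sD U : smooth_vfield A U -> smooth_at A (fun q => tder A q (U q) (coord_at p i)) p.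
  by move=> sU; exact: smooth_at_tder.
have vb U V : smooth_vfield A U -> smooth_vfield A V ->
    tder A p (vbracket A U V p) (coord_at p i) =
      tder A p (U p) (fun q => tder A q (V q) (coord_at p i)) -
      tder A p (V p) (fun q => tder A q (U q) (coord_at p i)).
  by move=> sU sV; exact: tder_vbracket.
have e1 : tder A p (Y p) (fun q => tder A q (X q + X' q) (coord_at p i)) =
    tder A p (Y p) (fun q => tder A q (X q) (coord_at p i))
    + tder A p (Y p) (fun q => tder A q (X' q) (coord_at p i)).
  apply: eq_trans (tderD _ (sD _ sX) (sD _ sX')).
  apply: tder_ext => //; apply: filterS (smooth_at_near sA sf) => q sfq.
  by rewrite tderDv.
pose proof (tderDv (X p) (X' p) (sD _ sY)) as e2.
pose proof (tderDv (vbracket A X Y p) (vbracket A X' Y p) sf) as e3.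
have aux (l r a b c d l1 r1 l2 r2 : R) : l = l1 - r1 -> l1 = a + b -> r1 = c + d ->
  l2 = a - c -> r2 = b - d -> r = l2 + r2 -> l = r.
  by move=> -> -> -> -> -> ->; ring.
exact: (aux _ _ _ _ _ _ _ _ _ _ (vb _ _ sXX' sY) e2 e1 (vb _ _ sX sY) (vb _ _ sX' sY) e3).
Qed.

Lemma vbracketZ (a : M -> R) X Y p : (forall p, smooth_at A a p) ->
  smooth_vfield A X -> smooth_vfield A Y ->
  vbracket A (fun q => a q *: X q) Y p =
    a p *: vbracket A X Y p - tder A p (Y p) a *: X p.
Proof.
move=> sa sX sY; have saX := smooth_vfieldZ sa sX.
apply: (vector_tder sA (p := p)) => i; have sf := smooth_coord_at p i; rewrite -/(coord_at p i).
have sD U : smooth_vfield A U -> smooth_at A (fun q => tder A q (U q) (coord_at p i)) p.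
  by move=> sU; exact: smooth_at_tder.
have vb U V : smooth_vfield A U -> smooth_vfield A V ->
    tder A p (vbracket A U V p) (coord_at p i) =
      tder A p (U p) (fun q => tder A q (V q) (coord_at p i)) -
      tder A p (V p) (fun q => tder A q (U q) (coord_at p i)).
  by move=> sU sV; exact: tder_vbracket.
have e2 (u v : E) (b c : R) : tder A p (b *: u - c *: v) (coord_at p i) =
    b * tder A p u (coord_at p i) - c * tder A p v (coord_at p i).
  by rewrite tderDv// tderNv// !tderZv.
have e1 : tder A p (Y p) (fun q => tder A q (a q *: X q) (coord_at p i)) =
    a p * tder A p (Y p) (fun q => tder A q (X q) (coord_at p i)) +
    tder A p (X p) (coord_at p i) * tder A p (Y p) a.
  apply: eq_trans (tderM sA _ (sa p) (sD _ sX)).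
  apply: tder_ext => //; apply: filterS (smooth_at_near sA sf) => q sfq.
  by rewrite tderZv.
pose proof (tderZv (a p) (X p) (sD _ sY)) as e3.
have aux (l r k b c d m l1 r1 l2 : R) : l = l1 - r1 -> l1 = k * b ->
  r1 = k * c + d * m -> l2 = b - c -> r = k * l2 - m * d -> l = r.
  by move=> -> -> -> -> ->; ring.
exact: (aux _ _ _ _ _ _ _ _ _ _ (vb _ _ saX sY) e3 e1 (vb _ _ sX sY) (e2 _ _ _ _)).
Qed.

Lemma d1D X X' Y p : smooth_vfield A X -> smooth_vfield A X' -> smooth_vfield A Y ->
  d1 A al (fun q => X q + X' q) Y p = d1 A al X Y p + d1 A al X' Y p.
Proof.
move=> sX sX' sY.
have e0 : (fun q => al q (X q + X' q) : R) = (fun q => al q (X q) + al q (X' q)).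
  by apply/funext => q; rewrite alD.
pose proof (eq_trans (congr1 (tder A p (Y p)) e0)
  (tderD _ (al_smooth p sX) (al_smooth p sX'))) as e1.
pose proof (tderDv (X p) (X' p) (al_smooth p sY)) as e2.
pose proof (eq_trans (congr1 (al p) (vbracketD p sX sX' sY)) (alD _ _ _)) as e3.
have aux (a b c a1 a2 b1 b2 c1 c2 : R) : a = a1 + a2 -> b = b1 + b2 ->
  c = c1 + c2 -> a - b - c = a1 - b1 - c1 + (a2 - b2 - c2).
  by move=> -> -> ->; ring.
exact: (aux _ _ _ _ _ _ _ _ _ e2 e1 e3).
Qed.

Lemma d1Z (a : M -> R) X Y p : (forall p, smooth_at A a p) ->
  smooth_vfield A X -> smooth_vfield A Y ->
  d1 A al (fun q => a q *: X q) Y p = a p * d1 A al X Y p.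
Proof.
move=> sa sX sY.
have e0 : (fun q => al q (a q *: X q) : R) = (fun q => a q * al q (X q)).
  by apply/funext => q; rewrite alZ.
pose proof (eq_trans (congr1 (tder A p (Y p)) e0)
  (tderM sA _ (sa p) (al_smooth p sX))) as e1.
pose proof (tderZv (a p) (X p) (al_smooth p sY)) as e2.
have e3 : al p (vbracket A (fun q => a q *: X q) Y p) =
    a p * al p (vbracket A X Y p) - tder A p (Y p) a * al p (X p).
  by rewrite vbracketZ// alB !alZ.
have aux (k b c m k1 b1 c1 d n : R) : k = m * k1 -> b = m * b1 + d * n ->
  c = m * c1 - n * d -> k - b - c = m * (k1 - b1 - c1).
  by move=> -> -> ->; ring.
exact: (aux _ _ _ _ _ _ _ _ _ e2 e1 e3).
Qed.

Section Frame.
Variables (K : Type) (F : K -> M -> E).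
Hypothesis (F_smooth : forall i, smooth_vfield A (F i)).

Lemma smooth_vfield_frame (a : K -> M -> R) (s : seq K) :
  (forall i p, smooth_at A (a i) p) ->
  smooth_vfield A (fun q => \sum_(i <- s) a i q *: F i q).
Proof.
move=> sa; elim: s => [|i s IH].
  have -> : (fun q => \sum_(i <- [::]) a i q *: F i q) = (fun=> 0).
    by apply/funext => q; rewrite big_nil.
  move=> p; apply: (smooth_at_ext sA (f := fun=> 0)).
    by near=> q; rewrite [RHS]tder0.
  exact: smooth_near_cst.
have -> : (fun q => \sum_(j <- i :: s) a j q *: F j q) =
    (fun q => a i q *: F i q + \sum_(j <- s) a j q *: F j q).
  by apply/funext => q; rewrite big_cons.
by apply: smooth_vfieldD => //; exact: smooth_vfieldZ.
Unshelve. all: by end_near.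
Qed.

Lemma d1_frame (a : K -> M -> R) (s : seq K) Y p :
  (forall i p, smooth_at A (a i) p) -> smooth_vfield A Y ->
  d1 A al (fun q => \sum_(i <- s) a i q *: F i q) Y p =
    \sum_(i <- s) a i p * d1 A al (F i) Y p.
Proof.
move=> sa sY; elim: s => [|i s IH].
  have s0 q : smooth_at A (fun=> 0 : R) q by exact: smooth_near_cst.
  have e : (fun q => \sum_(i <- [::]) a i q *: F i q) = (fun q => 0 *: Y q).
    by apply/funext => q; rewrite big_nil scale0r.
  by rewrite big_nil e (d1Z _ s0)// mul0r.
have e : (fun q => \sum_(j <- i :: s) a j q *: F j q) =
    (fun q => a i q *: F i q + \sum_(j <- s) a j q *: F j q).
  by apply/funext => q; rewrite big_cons.
have sai : smooth_vfield A (fun q => a i q *: F i q) by exact: smooth_vfieldZ.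
have sas := smooth_vfield_frame s sa.
by rewrite e big_cons d1D// d1Z// IH.
Qed.

(** Since [d al] is bilinear over smooth functions, its agreement with a
    bilinear form has to be checked on a frame only. *)
Lemma d1_on_frame (w : E -> E -> R) (a b : K -> M -> R) (s : seq K) p :
  (forall v, linear (w v : E -> R)) -> (forall v, linear (w ^~ v : E -> R)) ->
  (forall i j, w (F i p) (F j p) = - d1 A al (F i) (F j) p) ->
  (forall i p, smooth_at A (a i) p) -> (forall i p, smooth_at A (b i) p) ->
  let X q := \sum_(i <- s) a i q *: F i q in
  let Y q := \sum_(i <- s) b i q *: F i q in
  w (X p) (Y p) = - d1 A al X Y p.
Proof.
move=> wr wl wF sa sb X Y.
have sY : smooth_vfield A Y by exact: smooth_vfield_frame.
rewrite /X d1_frame// -sumrN.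
pose wL v : {linear E -> R} :=
  HB.pack (w ^~ v : E -> R) (GRing.isLinear.Build _ _ _ _ _ (wl v)).
rewrite -[LHS]/(wL (Y p) _) linear_sum; apply: eq_bigr => i _.
rewrite linearZZ -mulrN -[LHS]/(a i p * w (F i p) (Y p)); congr (_ * _).
rewrite d1_anti opprK /Y d1_frame//.
pose wR v : {linear E -> R} :=
  HB.pack (w v : E -> R) (GRing.isLinear.Build _ _ _ _ _ (wr v)).
rewrite -[LHS]/(wR (F i p) _) linear_sum; apply: eq_bigr => j _.
by rewrite linearZZ -[LHS]/(b j p * w (F i p) (F j p)) wF d1_anti opprK.
Qed.
End Frame.
End Forms.

(** * Smooth maps between manifolds *)

(** Continuity is asked for separately because the target chart is arbitrary
    outside its domain. *)
Definition smooth_map_at {R : realType} {E F : normedModType R}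
    {M N : topologicalType} (A : atlas E M) (B : atlas F N) (f : M -> N) (p : M) :=
  {for p, continuous f} /\ smooth_at A (fun q => chart B (f p) (f q)) p.

Section MapCalculus.
Context {R : realType} {E F : normedModType R} {fE : findim E} {fF : findim F}
  {M N : topologicalType} (A : atlas E M) (B : atlas F N)
  (sA : smooth_atlas A) (sB : smooth_atlas B).

(** Near [p] the map stays in the domain of the chart at [f p], so that [g \o f]
    can be computed through this chart. *)
Lemma near_comp_chart (f : M -> N) (p : M) (H : Type) (g : N -> H) :
  {for p, continuous f} ->
  {near chart A p p, ((g \o chart_inv B (f p)) \o
     ((fun q => chart B (f p) (f q)) \o chart_inv A p)) =1 (g \o f) \o chart_inv A p}.
Proof.
move=> cf; have := cf _ (sa_open sB (sa_dom sB (f p))).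
move=> /(near_chart_inv sA (sa_dom sA p)).
by apply: filterS => x; rewrite /= => /(sa_K sB) ->.
Qed.

Lemma smooth_at_comp (H : normedModType R) {fH : findim H} (g : N -> H) (f : M -> N) p :
  smooth_map_at A B f p -> smooth_at B g (f p) -> smooth_at A (g \o f) p.
Proof.
move=> [cf sf] sg; apply: (smooth_near_ext (near_comp_chart g cf)).
apply: smooth_near_comp; first exact: sf.
by rewrite /= (sa_K sA (sa_dom sA p)).
Qed.

Lemma tder_push (H : normedModType R) {fH : findim H} (g : N -> H) (f : M -> N) p v :
  smooth_map_at A B f p -> smooth_at B g (f p) ->
  tder B (f p) (push A B f p v) g = tder A p v (g \o f).
Proof.
move=> [cf sf] sg; rewrite /tder -(near_eq_derive _ (near_comp_chart g cf)).
rewrite smooth_near_chain //.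
  by rewrite /= (sa_K sA (sa_dom sA p)).
by rewrite /= (sa_K sA (sa_dom sA p)).
Qed.

Lemma tder_push_at (H : normedModType R) {fH : findim H} (g : N -> H) (f : M -> N) p q v :
  f p = q -> smooth_map_at A B f p -> smooth_at B g q ->
  tder B q (push A B f p v) g = tder A p v (g \o f).
Proof. by move=> <-; exact: tder_push. Qed.

Lemma push_linear (f : M -> N) p : smooth_map_at A B f p -> linear (push A B f p).
Proof. by move=> [_ sf]; exact: (tder_linear sf). Qed.

Lemma smooth_map_at_fst p : smooth_map_at (prod_atlas A B) A fst p.
Proof.
split; first exact: cvg_fst.
pose proof (smooth_at_chart (prod_smooth_atlas sA sB)
  (sa_dom (prod_smooth_atlas sA sB) p)) as s.
exact: (smooth_near_comp s (smooth_near_fst _)).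
Qed.

Lemma smooth_map_at_snd p : smooth_map_at (prod_atlas A B) B snd p.
Proof.
split; first exact: cvg_snd.
pose proof (smooth_at_chart (prod_smooth_atlas sA sB)
  (sa_dom (prod_smooth_atlas sA sB) p)) as s.
exact: (smooth_near_comp s (smooth_near_snd _)).
Qed.

Lemma smooth_map_at_id p : smooth_map_at A A id p.
Proof.
by split; [exact: cvg_id|exact: (smooth_at_chart sA (sa_dom sA p))].
Qed.

Lemma smooth_map_at_cst p (m : N) : smooth_map_at A B (fun=> m) p.
Proof. by split; [exact: cvg_cst|exact: smooth_near_cst]. Qed.
End MapCalculus.

Lemma smooth_map_at_pair {R : realType} {E F H : normedModType R}
    {fE : findim E} {fF : findim F} {fH : findim H}
    {M N O : topologicalType} (A : atlas E M) (B : atlas F N) (C : atlas H O)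
    (f : M -> N) (g : M -> O) p :
  smooth_map_at A B f p -> smooth_map_at A C g p ->
  smooth_map_at A (prod_atlas B C) (fun q => (f q, g q)) p.
Proof.
move=> [cf sf] [cg sg]; split; first exact: cvg_pair.
exact: (smooth_near_pair sf sg).
Qed.

Lemma smooth_map_at_comp {R : realType} {E F H : normedModType R}
    {fE : findim E} {fF : findim F} {fH : findim H}
    {M N O : topologicalType} (A : atlas E M) (B : atlas F N) (C : atlas H O)
    (sA : smooth_atlas A) (sB : smooth_atlas B) (g : N -> O) (f : M -> N) p :
  smooth_map_at A B f p -> smooth_map_at B C g (f p) ->
  smooth_map_at A C (fun q => g (f q)) p.
Proof.
move=> sf [cg sg]; split; first by apply: continuous_comp cg; case: sf.
exact: (smooth_at_comp sA sB sf sg).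
Qed.

Lemma smooth_map_smooth_map_at {R : realType} {E F : normedModType R}
    {M N : topologicalType} (A : atlas E M) (B : atlas F N) (f : M -> N) p :
  smooth_map A B f -> smooth_map_at A B f p.
Proof. by move=> [cf sf]; split; [exact: cf|exact: sf]. Qed.

(** * Derivatives depending on a parameter *)
Section Parametric.
Context {R : realType} {E F H : normedModType R} {fE : findim E} {fF : findim F}
  {fH : findim H} {M N : topologicalType} (A : atlas E M) (B : atlas F N).
Variables (h : M -> N -> H) (m : M) (n : N).
Hypothesis sh : smooth_at (prod_atlas A B) (fun x => h x.1 x.2) (m, n).

Let hh : E * F -> H := (fun x => h x.1 x.2) \o chart_inv (prod_atlas A B) (m, n).

Let sh' : smooth_near hh (chart A m m, chart B n n). Proof. exact: sh. Qed.

Lemma smooth_at_param v : smooth_at B (fun q => tder A m v (h^~ q)) n.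
Proof.
apply: (smooth_near_ext (f := fun y => 'D_(v, 0) hh (chart A m m, y))).
  by near=> y; rewrite derive_fst.
exact: (smooth_near_partial_snd (smooth_near_D _ sh')).
Unshelve. all: by end_near.
Qed.

Lemma tder_swap v w :
  tder B n w (fun q => tder A m v (h^~ q)) = tder A m v (fun a => tder B n w (h a)).
Proof.
have e1 : 'D_(0, w) ('D_(v, 0) hh) (chart A m m, chart B n n) =
    tder B n w (fun q => tder A m v (h^~ q)).
  apply: (eq_trans (derive_snd _ _ _ _)).
  apply: (congr1 (fun f => 'D_w f (chart B n n))); apply/funext => y.
  exact: derive_fst.
have e2 : 'D_(v, 0) ('D_(0, w) hh) (chart A m m, chart B n n) =
    tder A m v (fun a => tder B n w (h a)).
  apply: (eq_trans (derive_fst _ _ _ _)).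
  apply: (congr1 (fun f => 'D_v f (chart A m m))); apply/funext => y.
  exact: derive_snd.
by rewrite -e1 -e2; exact: Schwarz.
Qed.

Lemma tder_param_chain (G : normedModType R) {fG : findim G} (c : M -> G)
   (W : {linear G -> F}) v : smooth_at A c m -> smooth_atlas A ->
  tder A m v (fun a => tder B n (W (c a)) (h a)) =
    tder B n (W (tder A m v c)) (h m) +
    tder A m v (fun a => tder B n (W (c m)) (h a)).
Proof.
move=> sc sA.
have cm : (c \o chart_inv A m) (chart A m m) = c m.
  by rewrite /= (sa_K sA (sa_dom sA m)).
(* In charts, [h] is differentiated at the point [ga x] in the direction [et x]. *)
pose ga (x : E) := (x, chart B n n).
pose et (x : E) := (0 : E, W ((c \o chart_inv A m) x)).
have sga : smooth_near ga (chart A m m).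
  by apply: smooth_near_pair; [exact: smooth_near_id|exact: smooth_near_cst].
have sW : smooth_near (fun x => W ((c \o chart_inv A m) x)) (chart A m m).
  exact: smooth_near_lin.
have set : smooth_near et (chart A m m).
  by apply: smooth_near_pair => //; exact: smooth_near_cst.
have dga : 'D_v ga (chart A m m) = (v, 0).
  rewrite /ga derive_pair; [|exact: smooth_near_id|exact: smooth_near_cst].
  by rewrite derive_id -[X in (_, X)]/('D_v (cst _) _) derive_cst.
have det : 'D_v et (chart A m m) = (0, W (tder A m v c)).
  rewrite /et derive_pair//; last exact: smooth_near_cst.
  rewrite -[X in (X, _)]/('D_v (cst _) _) derive_cst; congr (_, _).
  apply: (derive_linear _ _).2; first exact: findim_linear_cont.
  exact: smooth_near_derivable.
have e0 : 'D_v (fun x => 'D_(et x) hh (ga x)) (chart A m m) =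
    tder A m v (fun a => tder B n (W (c a)) (h a)).
  apply: (congr1 (fun f => 'D_v f (chart A m m))); apply/funext => x.
  exact: derive_snd.
rewrite -e0 (derive_dir _ sga set sh') dga det; congr (_ + _).
  apply: (eq_trans (derive_snd _ _ _ _)).
  apply: (congr1 (fun f => 'D_(W (tder A m v c)) f (chart B n n))).
  by apply/funext => y; rewrite /hh /= (sa_K sA (sa_dom sA m)).
rewrite /et cm; apply: (eq_trans (derive_fst _ _ _ _)).
apply: (congr1 (fun f => 'D_v f (chart A m m))); apply/funext => x.
exact: derive_snd.
Qed.
End Parametric.

(** * The derivative of the adjoint action *)
Section LieGroupCalculus.
Context {R : realType} {n : nat} (G : lieGroupType R n).
Local Notation atG := (@lie_atlas R n G).
Local Notation g := 'rV[R]_n.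
Local Notation TP := ('rV[R]_n * 'rV[R]_n)%type.
Local Notation P := (G * 'rV[R]_n)%type.
Local Notation atP := (bundle_atlas G : atlas TP P).
Implicit Types (a b : G) (x y z : g).

Lemma lie_smooth_atlas : smooth_atlas atG.
Proof. exact: (manifold_atlas lie_manifold). Qed.
Local Notation sG := lie_smooth_atlas.

Lemma bundle_smooth_atlas : smooth_atlas atP.
Proof. exact: (prod_smooth_atlas sG (vector_smooth_atlas (E := g))). Qed.
Local Notation sP := bundle_smooth_atlas.

Section SmoothMul.
Context {E : normedModType R} {fE : findim E} {M : topologicalType} (A : atlas E M)
  (sA : smooth_atlas A).

Lemma smooth_map_at_mul (f h : M -> G) p :
  smooth_map_at A atG f p -> smooth_map_at A atG h p ->
  smooth_map_at A atG (fun q => (f q * h q)%g) p.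
Proof.
move=> sf sh.
apply: (smooth_map_at_comp (g := fun xy : G * G => (xy.1 * xy.2)%g) sA
  (prod_smooth_atlas sG sG) (smooth_map_at_pair sf sh)).
by apply: smooth_map_smooth_map_at; exact: lie_mul_smooth.
Qed.

Lemma smooth_map_at_inv (f : M -> G) p :
  smooth_map_at A atG f p -> smooth_map_at A atG (fun q => (f q)^-1%g) p.
Proof.
move=> sf; apply: (smooth_map_at_comp (g := fun x : G => (x^-1)%g) sA sG sf).
by apply: smooth_map_smooth_map_at; exact: lie_inv_smooth.
Qed.

Lemma smooth_map_at_act (f : M -> G) (h : M -> P) p :
  smooth_map_at A atG f p -> smooth_map_at A atP h p ->
  smooth_map_at A atP (fun q => bundle_act (f q) (h q)) p.
Proof.
move=> sf sh; apply: smooth_map_at_pair.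
  apply: smooth_map_at_mul => //.
  apply: (smooth_map_at_comp sA sP sh).
  exact: (smooth_map_at_fst sG (vector_smooth_atlas (E := g))).
apply: (smooth_map_at_comp sA sP sh).
exact: (smooth_map_at_snd sG (vector_smooth_atlas (E := g))).
Qed.
End SmoothMul.

Lemma conj1 a : (a * 1 * a^-1)%g = 1%g.
Proof. by rewrite mulg1 mulgV. Qed.

Lemma smooth_conj a b : smooth_map_at atG atG (fun b => (a * b * a^-1)%g) b.
Proof.
do ?[apply: (smooth_map_at_mul sG)]; try exact: smooth_map_at_cst.
exact: smooth_map_at_id sG _.
Qed.

Lemma tder_Ad (F : normedModType R) {fF : findim F} (f : G -> F) a y :
  smooth_at atG f 1%g ->
  tder atG 1%g (Ad a y) f = tder atG 1%g y (fun b => f (a * b * a^-1)%g).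
Proof.
move=> sf; exact: (tder_push_at (f := fun b => (a * b * a^-1)%g) sG sG y (conj1 a) (smooth_conj a 1%g) sf).
Qed.

Lemma AdK a y : Ad a^-1%g (Ad a y) = y.
Proof.
have sc : smooth_at atG (chart atG 1%g) (1%g : G).
  by apply: smooth_at_chart; [exact: sG|exact: sa_dom sG _].
have sc' : smooth_at atG (fun b : G => chart atG 1%g (a^-1 * b * (a^-1)^-1)%g) 1%g.
  apply: (smooth_at_comp sG sG (smooth_conj a^-1%g 1%g)).
  by rewrite conj1.
rewrite -[LHS](tder_id sG 1%g) tder_Ad// tder_Ad//.
have e : (fun b : G => chart atG 1%g (a^-1 * (a * b * a^-1) * (a^-1)^-1)%g) = chart atG 1%g.
  by apply/funext => b; rewrite -!mulgA !mulKg invgK mulVg mulg1.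
by rewrite e tder_id//; exact: sG.
Qed.

Lemma Ad1 y : Ad (1^-1 : G)%g y = y.
Proof.
have sc : smooth_at atG (chart atG 1%g) (1%g : G).
  by apply: smooth_at_chart; [exact: sG|exact: sa_dom sG _].
rewrite -[LHS](tder_id sG 1%g) tder_Ad//.
have e : (fun b : G => chart atG 1%g (1^-1 * b * (1^-1)^-1)%g) = chart atG 1%g.
  by apply/funext => b; rewrite !invg1 mul1g mulg1.
by rewrite e tder_id//; exact: sG.
Qed.

Let phi : G -> g := chart atG 1%g.
Let sphi : smooth_at atG phi 1%g.
Proof. by apply: smooth_at_chart; [exact: sG|exact: sa_dom sG _]. Qed.

Lemma smooth_Ad_inv y : smooth_at atG (fun a : G => Ad a^-1%g y) 1%g.
Proof.
have -> : (fun a : G => Ad a^-1%g y) =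
    (fun a => tder atG 1%g y (fun b => phi (a^-1 * b * (a^-1)^-1)%g)).
  apply/funext => a; apply: esym.
  exact: (eq_trans (esym (tder_Ad _ _ sphi)) (tder_id sG _ _)).
apply: (smooth_at_param (A := atG) (B := atG)
  (h := fun b a => phi (a^-1 * b * (a^-1)^-1)%g)).
pose proof (prod_smooth_atlas sG sG) as s11.
pose proof (smooth_map_at_fst sG sG (1%g, 1%g)) as s1.
pose proof (smooth_map_at_snd sG sG (1%g, 1%g)) as s2.
suff H : smooth_at (prod_atlas atG atG)
    (phi \o (fun x : G * G => (x.2^-1 * x.1 * (x.2^-1)^-1)%g)) (1%g, 1%g) by exact: H.
apply: (smooth_at_comp s11 sG).
  apply: smooth_map_at_mul => //; last first.
    by apply: smooth_map_at_inv => //; exact: smooth_map_at_inv.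
  by apply: smooth_map_at_mul => //; exact: smooth_map_at_inv.
by rewrite /= conj1.
Qed.

(** The mixed second derivative of the multiplication at the identity, [x] being
    the direction of the left factor. *)
Let T x y : g := tder atG 1%g x (fun a => tder atG 1%g y (fun b => phi (a * b)%g)).

Let smul : smooth_at (prod_atlas atG atG) (fun ab : G * G => phi (ab.1 * ab.2)%g) (1%g, 1%g).
Proof.
suff H : smooth_at (prod_atlas atG atG)
    (phi \o (fun x : G * G => (x.1 * x.2)%g)) (1%g, 1%g) by exact: H.
apply: (smooth_at_comp (prod_smooth_atlas sG sG) sG).
  by apply: smooth_map_smooth_map_at; exact: lie_mul_smooth.
by rewrite /= mulg1.
Qed.

Let left_vfield1 x : left_vfield x (1%g : G) = x.
Proof.
rewrite /left_vfield /push mulg1.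
have -> : (fun q : G => chart atG 1%g (1 * q)%g) = phi.
  by apply/funext => b; rewrite mul1g.
by rewrite tder_id//; exact: sG.
Qed.

Let smooth_left a b : smooth_map_at atG atG (fun b => (a * b)%g) b.
Proof.
apply: (smooth_map_at_mul sG); first exact: smooth_map_at_cst.
exact: smooth_map_at_id sG _.
Qed.

Let left_vfieldE y : {near (1%g : G), (fun a => tder atG a (left_vfield y a) phi) =1
  (fun a => tder atG 1%g y (fun b => phi (a * b)%g))}.
Proof.
apply: filterS (smooth_at_near sG sphi) => a sa.
exact: (tder_push_at (f := fun b => (a * b)%g) sG sG y (mulg1 a) (smooth_left a 1%g) sa).
Qed.

(** A left-invariant field is the derivative of the multiplication in its right
    factor, so its derivative is the mixed one. *)
Lemma lie_bracketE x y : lie_bracket G x y = T x y - T y x.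
Proof.
rewrite /lie_bracket /vbracket !left_vfield1.
exact: (congr2 (fun u v : g => u - v) (tder_ext sG x (left_vfieldE y))
                                  (tder_ext sG y (left_vfieldE x))).
Qed.

(** Differentiate [a (Ad(a^-1) y) = y a] (translations applied to tangent
    vectors) in [a] at the identity along [x].  With [T x y] the mixed second
    derivative of the multiplication, the left-hand side gives the wanted
    derivative plus [T x y], and the right-hand side gives [T y x] after
    exchanging the order of differentiation. *)
Lemma tder_Ad_inv x y : tder atG 1%g x (fun a : G => Ad a^-1%g y) = lie_bracket G y x.
Proof.
(* The identity [a (Ad(a^-1) y) = y a], read in the chart at the identity. *)
have lr : {near (1%g : G), (fun a => tder atG 1%g (Ad a^-1%g y) (fun b => phi (a * b)%g))
   =1 (fun a => tder atG 1%g y (fun b => phi (b * a)%g))}.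
  apply: filterS (smooth_at_near sG sphi) => a sa.
  have sl : smooth_at atG (fun b => phi (a * b)%g) 1%g.
    by apply: (smooth_at_comp sG sG (smooth_left a 1%g)); rewrite mulg1.
  rewrite (tder_Ad _ _ sl); congr (tder _ _ _ _); apply/funext => b.
  by rewrite invgK !mulgA mulgV mul1g.
have e1 := tder_ext sG x lr.
pose proof (tder_param_chain (h := fun a b => phi (a * b)%g) smul idfun x (smooth_Ad_inv y) sG) as e2.
pose proof (tder_swap (h := fun a b => phi (a * b)%g) smul y x) as e3.
have e4 z : tder atG 1%g z (fun b => phi (1 * b)%g) = z.
  rewrite (_ : (fun b => phi (1 * b)%g) = phi); first exact: tder_id sG _ _.
  by apply/funext => b; rewrite mul1g.
have e5 : tder atG 1%g x (fun a => tder atG 1%g (Ad (1^-1 : G)%g y) (fun b => phi (a * b)%g))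
    = T x y by exact: (congr1 (T x) (Ad1 y)).
have aux (u v w w' s s' t : g) : u = v -> u = w + s -> v = t -> w = w' -> s = s' ->
  w' = t - s' by move=> -> -> <- -> ->; rewrite addrK.
rewrite lie_bracketE; exact: (aux _ _ _ _ _ _ _ e1 e2 e3 (e4 _) e5).
Qed.
End LieGroupCalculus.

(** * The trivial bundle *)
Section Bundle.
Context {R : realType} {n : nat} (G : lieGroupType R n).
Local Notation atG := (@lie_atlas R n G).
Local Notation g := 'rV[R]_n.
Local Notation TP := ('rV[R]_n * 'rV[R]_n)%type.
Local Notation P := (G * 'rV[R]_n)%type.
Local Notation atP := (bundle_atlas G : atlas TP P).
Local Notation sG := (lie_smooth_atlas G).
Local Notation sP := (bundle_smooth_atlas G).
Implicit Types (a b : G) (x y z : g) (p q : P).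

Lemma act1 p : bundle_act (1%g : G) p = p.
Proof. by case: p => a w; rewrite /bundle_act /= mul1g. Qed.

Lemma actM a b p : bundle_act (a * b)%g p = bundle_act a (bundle_act b p).
Proof. by rewrite /bundle_act /= mulgA. Qed.

Lemma smooth_act a p : smooth_map_at atP atP (bundle_act a : P -> P) p.
Proof.
apply: (smooth_map_at_act sP (f := fun=> a) (h := id)).
  exact: smooth_map_at_cst.
exact: smooth_map_at_id sP _.
Qed.

Lemma smooth_orbit p a : smooth_map_at atG atP (fun a => bundle_act a p : P) a.
Proof.
apply: (smooth_map_at_act sG (f := id) (h := fun=> p)).
  exact: smooth_map_at_id sG _.
exact: smooth_map_at_cst.
Qed.

Section FunctionsOnBundle.
Context {F : normedModType R} {fF : findim F}.
Implicit Types f : P -> F.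

Lemma tder_fund f p x : smooth_at atP f p ->
  tder atP p (fund x p) f = tder atG 1%g x (fun a => f (bundle_act a p)).
Proof.
exact: (tder_push_at (f := fun a => bundle_act a p : P) sG sP x (act1 p)
  (smooth_orbit p 1%g)).
Qed.

Lemma tder_act_push f a p v : smooth_at atP f (bundle_act a p) ->
  tder atP (bundle_act a p) (act_push a p v) f =
    tder atP p v (fun q => f (bundle_act a q)).
Proof. exact: (tder_push sP sP v (smooth_act a p)). Qed.

Lemma smooth_at_act2 f p : smooth_at atP f p ->
  smooth_at (prod_atlas atG atP) (fun x : G * P => f (bundle_act x.1 x.2)) (1%g, p).
Proof.
move=> sf.
suff H : smooth_at (prod_atlas atG atP)
    (f \o (fun x : G * P => bundle_act x.1 x.2 : P)) (1%g, p) by exact: H.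
pose proof (prod_smooth_atlas sG sP) as sGP.
apply: (smooth_at_comp sGP sP); last by rewrite act1.
apply: (smooth_map_at_act sGP (f := fst) (h := snd)).
  exact: smooth_map_at_fst sG sP _.
exact: smooth_map_at_snd sG sP _.
Qed.
End FunctionsOnBundle.

Lemma fund_linear p : linear (fun x => fund x p : TP).
Proof. exact: (push_linear (smooth_orbit p 1%g)). Qed.

Lemma act_push_linear a p : linear (act_push a p : TP -> TP).
Proof. exact: (push_linear (smooth_act a p)). Qed.

Lemma smooth_fund x : smooth_vfield atP (fund x : P -> TP).
Proof.
move=> p.
have sc : smooth_at atP (chart atP p) p.
  by apply: smooth_at_chart; [exact: sP|exact: sa_dom sP _].
apply: (smooth_at_ext sP (f := fun q => tder atG 1%g x (fun a => chart atP p (bundle_act a q)))).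
  apply: filterS (smooth_at_near sP sc) => q sq.
  exact: (esym (tder_fund x sq)).
exact: (smooth_at_param (h := fun a q => chart atP p (bundle_act a q)) (smooth_at_act2 sc)).
Qed.

Let chart_smooth p : smooth_at atP (chart atP p) p.
Proof. by apply: smooth_at_chart; [exact: sP|exact: sa_dom sP _]. Qed.

Lemma fund_act a y p :
  fund y (bundle_act a p) = act_push a p (fund (Ad a^-1%g y) p) :> TP.
Proof.
set q : P := bundle_act a p.
rewrite -[LHS](tder_id sP q) -[RHS](tder_id sP q).
pose proof (tder_fund y (chart_smooth q)) as e1.
pose proof (tder_act_push (fund (Ad a^-1%g y) p) (chart_smooth q)) as e2.
have s3 : smooth_at atP (fun r : P => chart atP q (bundle_act a r)) p.
  exact: (smooth_at_comp sP sP (smooth_act a p) (chart_smooth q)).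
pose proof (tder_fund (Ad a^-1%g y) s3) as e3.
have s4 : smooth_at atG (fun b => chart atP q (bundle_act a (bundle_act b p))) 1%g.
  have s3' : smooth_at atP (fun r : P => chart atP q (bundle_act a r))
    (bundle_act (1%g : G) p) by rewrite act1.
  exact: (smooth_at_comp sG sP (smooth_orbit p 1%g) s3').
pose proof (tder_Ad (a^-1)%g y s4) as e4.
apply: (eq_trans e1); apply: esym; apply: (eq_trans e2).
apply: (eq_trans e3); apply: (eq_trans e4).
apply: (congr1 (tder atG 1%g y)); apply/funext => b.
by rewrite -!actM invgK !mulgA mulgV mul1g.
Qed.

Lemma act_push_fund a x p :
  act_push a p (fund x p) = fund (Ad a x) (bundle_act a p) :> TP.
Proof. by rewrite fund_act AdK. Qed.

(** For a family [W y] of vector fields which is linear in [y] and permuted by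
    the action, [[x^#, W y] = - W [x,y]].  Indeed [x^#(W y f)] is the derivative at
    the identity along [x] of [a |-> (W (Ad(a^-1) y))_p (f (a .))]; the variation
    of [Ad(a^-1) y] contributes [W [y,x] f], and the variation of [f (a .)]
    contributes [W y (x^# f)] by symmetry of second derivatives. *)
Lemma vbracket_fund (W : P -> {linear g -> TP}) x y p :
  (forall a q y, W (bundle_act a q) y = act_push a q (W q (Ad a^-1%g y))) ->
  (forall y, smooth_vfield atP (fun q => W q y)) ->
  vbracket atP (fund x) (fun q => W q y) p = - W p (lie_bracket G x y).
Proof.
move=> Wact Wsm.
have sc := chart_smooth p; set f := chart atP p in sc.
have vN : lie_bracket G y x = - lie_bracket G x y by exact: vbracketN.
rewrite -linearN -vN -[LHS](tder_id sP p) -[RHS](tder_id sP p) -/f.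
apply: (eq_trans (tder_vbracket sP (smooth_fund x) (Wsm y) sc)).
have sWf : smooth_at atP (fun q => tder atP q (W q y) f) p.
  exact: (smooth_at_tder sP (Wsm y) sc).
have sxf : smooth_at atP (fun q => tder atP q (fund x q) f) p.
  exact: (smooth_at_tder sP (smooth_fund x) sc).
pose proof (smooth_at_act2 sc) as sf2.
have near_orbit : \forall a \near (1%g : G), smooth_at atP f (bundle_act a p).
  have [cont _] := smooth_orbit p 1%g.
  have cont1 : (fun a => bundle_act a p : P) @ (1%g : G) --> (p : P).
    by rewrite -[X in _ --> X]act1; exact: cont.
  exact: (cont1 _ (smooth_at_near sP sc)).
have e1 : tder atG 1%g x (fun a => tder atP (bundle_act a p) (W (bundle_act a p) y) f) =
   tder atG 1%g x (fun a => tder atP p (W p (Ad a^-1%g y)) (fun q => f (bundle_act a q))).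
  apply: (tder_ext sG); apply: filterS near_orbit => a sa.
  by apply: (eq_trans _ (tder_act_push _ sa)); rewrite Wact.
(* Both [W p (Ad a^-1 y)] and [f (bundle_act a q)] vary with [a]. *)
pose proof (tder_param_chain (h := fun a q => f (bundle_act a q)) sf2 (W p) x
  (smooth_Ad_inv G y) sG) as e2.
pose proof (tder_swap (h := fun a q => f (bundle_act a q)) sf2 x (W p y)) as e3.
have e4 : tder atP p (W p y) (fun q => tder atG 1%g x (fun a => f (bundle_act a q))) =
   tder atP p (W p y) (fun q => tder atP q (fund x q) f).
  apply: (tder_ext sP); apply: filterS (smooth_at_near sP sc) => q sq.
  exact: (esym (tder_fund x sq)).
have e5 : tder atP p (W p (tder atG 1%g x (fun a : G => Ad a^-1%g y)))
    (fun q => f (bundle_act (1%g : G) q)) = tder atP p (W p (lie_bracket G y x)) f.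
  rewrite tder_Ad_inv; congr (tder _ _ _ _); apply/funext => q; by rewrite act1.
have e6 : tder atG 1%g x (fun a => tder atP p (W p (Ad (1^-1 : G)%g y)) (fun q => f (bundle_act a q)))
  = tder atG 1%g x (fun a => tder atP p (W p y) (fun q => f (bundle_act a q))).
  exact: (congr1 (fun z => tder atG 1%g x (fun a => tder atP p (W p z)
     (fun q => f (bundle_act a q)))) (Ad1 G y)).
have aux (u1 u2 v s s' s'' t t' w : TP) : u1 = u2 -> u2 = v -> v = s + t -> s = s' -> t = t' ->
  w = t' -> w = s'' -> u1 - s'' = s'.
  by move=> -> -> -> -> -> <- <-; rewrite addrK.
exact: (aux _ _ _ _ _ _ _ _ _ (tder_fund x sWf) e1 e2 e5 e6 e3 e4).
Qed.

(** The derivative at the identity of [<mu(a p), x> = <mu(p), Ad(a^-1) x>]. *)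
Lemma tder_fund_equivariant (mu : P -> lieDual R n) x y p :
  smooth_dual mu -> coadjoint_equivariant mu ->
  tder atP p (fund y p) (fun q => mu q x : R) = mu p (lie_bracket G x y).
Proof.
move=> smu emu; apply: (eq_trans (tder_fund y (smu x p))).
have -> : (fun a => mu (bundle_act a p) x : R) = (fun a => mu p (Ad a^-1%g x)).
  by apply/funext => a; exact: emu.
rewrite -tder_Ad_inv.
have c : continuous (mu p : g -> R).
  by apply: (findim_linear_cont (F := R)).
have d : derivable ((fun a : G => Ad a^-1%g x) \o chart_inv atG (1%g : G)) (chart atG 1%g 1%g) y.
  by apply: smooth_near_derivable; exact: smooth_Ad_inv.
exact: (derive_linear (l := mu p : {linear g -> R}) c d).2.
Qed.
End Bundle.

(** * Smoothness of components in a frame *)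
Section Cramer.
Context {R : realType} {E : normedModType R}.

Lemma smooth_near_det m (A : E -> 'M[R]_m) x :
  (forall i j, smooth_near (fun y => A y i j : R) x) ->
  smooth_near (fun y => \det (A y) : R) x.
Proof.
move=> sA; rewrite /determinant.
apply: smooth_near_sum => s; apply: smooth_nearM; first exact: smooth_near_cst.
by apply: smooth_near_prod => i; exact: sA.
Qed.

(** Cramer's rule: the solution of a linear system is a quotient of polynomials in
    its coefficients. *)
Lemma smooth_near_solve m (A : E -> 'M[R]_m) (a b : E -> 'rV[R]_m) x k :
  (forall i j, smooth_near (fun y => A y i j : R) x) ->
  (forall j, smooth_near (fun y => b y 0 j : R) x) ->
  A x \in unitmx -> {near x, (fun y => a y *m A y) =1 b} ->
  smooth_near (fun y => a y 0 k : R) x.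
Proof.
move=> sA sb Ax ab.
have sdet := smooth_near_det sA.
have det0 : \det (A x) != 0 by rewrite -unitfE.
have ndet : \forall y \near x, \det (A y) != 0.
  exact: (cvgr_neq0 _ (smooth_near_cont sdet) det0).
apply: (smooth_near_ext
  (f := fun y => \sum_j b y 0 j * ((\det (A y))^-1 * cofactor (A y) k j) : R)).
  apply: filterS2 ab ndet => y aby dy.
  have uy : A y \in unitmx by rewrite unitmxE unitfE.
  rewrite -(mulmxK uy (a y)) aby mxE; apply: eq_bigr => j _.
  by rewrite /invmx uy !mxE.
apply: smooth_near_sum => j; apply: smooth_nearM => //.
apply: smooth_nearM; first exact: smooth_nearV.
apply: smooth_nearM; first exact: smooth_near_cst.
apply: smooth_near_det => i l.
by apply: (smooth_near_ext _ (sA (lift k i) (lift j l))); near=> y; rewrite !mxE.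
Unshelve. all: by end_near.
Qed.
End Cramer.

Section SplitTangent.
Context {R : realType} {n : nat} (G : lieGroupType R n).
Local Notation g := 'rV[R]_n.
Local Notation TP := ('rV[R]_n * 'rV[R]_n)%type.
Local Notation P := (G * 'rV[R]_n)%type.
Local Notation atP := (bundle_atlas G : atlas TP P).
Local Notation sP := (bundle_smooth_atlas G).
Implicit Types (a b : G) (x y z : g) (p q : P).

Definition fund_at p : g -> TP := fun x => fund x p.
Fact fund_at_linear p : linear (fund_at p). Proof. exact: fund_linear. Qed.
HB.instance Definition _ p := GRing.isLinear.Build R g TP _ (fund_at p) (fund_at_linear p).

Variables (I : P -> {linear TP -> TP}) (theta L : P -> {linear TP -> g}).
Hypotheses (I_complex : complex_structure atP I)
  (I_decomposition : forall p v, exists! xy : g * g,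
     v = fund xy.1 p + I p (fund xy.2 p))
  (theta_def : forall p x y, theta p (fund x p + I p (fund y p)) = x)
  (L_def : forall p x y, L p (fund x p + I p (fund y p)) = y).

Lemma splitE p v : v = fund (theta p v) p + I p (fund (L p v) p).
Proof.
have [[x y] [/= e _]] := I_decomposition p v.
by rewrite [in RHS]e theta_def L_def.
Qed.

Lemma fund0 p : fund 0 p = 0 :> TP.
Proof. exact: (linear0 (fund_at p)). Qed.

Lemma theta_fund p x : theta p (fund x p) = x.
Proof. by have := theta_def p x 0; rewrite fund0 linear0 addr0. Qed.

Lemma L_fund p x : L p (fund x p) = 0.
Proof. by have := L_def p x 0; rewrite fund0 linear0 addr0. Qed.

Lemma theta_Ifund p y : theta p (I p (fund y p)) = 0.
Proof. by have := theta_def p 0 y; rewrite fund0 add0r. Qed.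

Lemma L_Ifund p y : L p (I p (fund y p)) = y.
Proof. by have := L_def p 0 y; rewrite fund0 add0r. Qed.

Lemma I_square p v : I p (I p v) = - v.
Proof. by case: I_complex => _ + _; apply. Qed.

Lemma theta_I p v : theta p (I p v) = - L p v.
Proof.
rewrite [in LHS](splitE p v) linearD I_square linearB theta_Ifund theta_fund.
by rewrite sub0r.
Qed.

Lemma L_I p v : L p (I p v) = theta p v.
Proof.
rewrite [in LHS](splitE p v) linearD I_square linearB L_Ifund L_fund.
by rewrite subr0.
Qed.

Lemma smooth_Ifund y : smooth_vfield atP (fun q => I q (fund y q)).
Proof. by case: I_complex => sI _ _; exact: (sI _ (smooth_fund y)). Qed.

(** The global frame made of the fields [e_i^#] (first half of the indices) and
    [I e_i^#] (second half), for the standard basis [e_i] of the Lie algebra. *)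
Definition split_frame (k : 'I_(n + n)) : P -> TP := fun q =>
  match fintype.split k with
  | inl i => fund (delta_mx 0 i) q
  | inr i => I q (fund (delta_mx 0 i) q)
  end.

Lemma smooth_split_frame k : smooth_vfield atP (split_frame k).
Proof.
rewrite /split_frame; case: (fintype.split k) => i; first exact: smooth_fund.
exact: smooth_Ifund.
Qed.

Lemma split_frameE p (v : 'rV[R]_(n + n)) :
  \sum_k v 0 k *: split_frame k p = fund (lsubmx v) p + I p (fund (rsubmx v) p).
Proof.
rewrite big_split_ord /=; congr (_ + _).
  rewrite -[RHS]/(fund_at p _) [lsubmx v in RHS]row_sum_delta linear_sum.
  apply: eq_bigr => i _; rewrite linearZ mxE; congr (_ *: _).
  by rewrite /split_frame (unsplitK (inl _)).
rewrite -[RHS]/(I p (fund_at p _)) [rsubmx v in RHS]row_sum_delta !linear_sum.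
apply: eq_bigr => i _; rewrite !linearZ mxE; congr (_ *: _).
by rewrite /split_frame (unsplitK (inr _)).
Qed.

Definition split_row p (v : TP) : 'rV[R]_(n + n) := row_mx (theta p v) (L p v).

Lemma split_rowE p v : v = \sum_k split_row p v 0 k *: split_frame k p.
Proof. by rewrite split_frameE row_mxKl row_mxKr -splitE. Qed.

Let fT : findim (TP : normedModType R) :=
  @findim_prod R _ _ (@findim_rV R n) (@findim_rV R n).
Let tangent_coord (j : 'I_(n + n)) : {linear TP -> R} := @fcoord _ _ fT j.

(** [theta] and [L] are only given pointwise; their smoothness comes from solving
    for the components of [X] in the smooth frame [split_frame]. *)
Lemma smooth_split_row (X : P -> TP) p k : smooth_vfield atP X ->
  smooth_at atP (fun q => split_row q (X q) 0 k : R) p.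
Proof.
move=> sX; have pp := sa_dom sP p.
pose c : P -> TP := chart atP p.
pose A q : 'M[R]_(n + n) := \matrix_(i, j) tangent_coord j (tder atP q (split_frame i q) c).
pose b q : 'rV[R]_(n + n) := \row_j tangent_coord j (tder atP q (X q) c).
apply: (smooth_near_solve (A := A \o chart_inv atP p)
  (a := (fun q => split_row q (X q)) \o chart_inv atP p) (b := b \o chart_inv atP p)).
- move=> i j; apply: (smooth_near_ext (f := fun u : TP =>
    tangent_coord j (((fun q => tder atP q (split_frame i q) c) \o chart_inv atP p) u) : R)).
    by near=> y; rewrite /= mxE.
  by apply: smooth_near_lin; exact: smooth_split_frame.
- move=> j; apply: (smooth_near_ext (f := fun u : TP =>
    tangent_coord j (((fun q => tder atP q (X q) c) \o chart_inv atP p) u) : R)).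
    by near=> y; rewrite /= mxE.
  by apply: smooth_near_lin; exact: sX.
(* A relation between the rows is a relation between the frame fields at [p]. *)
- have eA : (A \o chart_inv atP p) (chart atP p p) = A p by exact: (congr1 A (sa_K sP pp)).
  rewrite eA -row_free_unit; apply: inj_row_free => v vA.
  have : \sum_k v 0 k *: split_frame k p = 0.
    apply: (eq_trans (@fcoordE _ _ fT _)); apply: big1 => j _.
    suff -> : @fcoord _ _ fT j (\sum_k v 0 k *: split_frame k p) = 0 by rewrite scale0r.
    have := congr1 (fun M : 'rV_(n + n) => M 0 j) vA; rewrite [RHS]mxE => e.
    apply: (eq_trans _ e); rewrite linear_sum [RHS]mxE; apply: eq_bigr => i _.
    by rewrite linearZZ mxE (tder_id sP).
  rewrite split_frameE => e0.
  have := theta_def p (lsubmx v) (rsubmx v); rewrite e0 linear0 => l0.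
  have := L_def p (lsubmx v) (rsubmx v); rewrite e0 linear0 => r0.
  by rewrite -[v]hsubmxK -l0 -r0 row_mx0.
- suff nq : \forall q \near p, split_row q (X q) *m A q = b q.
    exact: (near_chart_inv sP pp nq).
  apply: filterS (sa_open sP pp) => q pq.
  apply/rowP => j; rewrite [LHS]mxE [RHS]mxE.
  pose proof (smooth_at_chart sP pq) as sc.
  have lin : linear (fun v => tder atP q v c) by exact: tder_linear.
  (* [T] is the change from the chart at [q] to the chart at [p]. *)
pose T : {linear TP -> TP} :=
    HB.pack (fun v => tder atP q v c) (GRing.isLinear.Build _ _ _ _ _ lin).
  have -> : tder atP q (X q) c = T (\sum_k split_row q (X q) 0 k *: split_frame k q).
    exact: (congr1 T (split_rowE q (X q))).
  rewrite !linear_sum; apply: eq_bigr => i _; rewrite !linearZZ.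
  by rewrite [X in _ * X]mxE.
Unshelve. all: by end_near.
Qed.

Lemma smooth_theta (X : P -> TP) p i : smooth_vfield atP X ->
  smooth_at atP (fun q => theta q (X q) 0 i : R) p.
Proof.
move=> /(smooth_split_row p (lshift n i)).
by apply: smooth_near_ext; near=> y; rewrite /= row_mxEl.
Unshelve. all: by end_near.
Qed.

End SplitTangent.

(** * Linear algebra of the criterion *)
Lemma linfunE (K : fieldType) (V W : vectType K) (f : V -> W) : linear f ->
  forall v, linfun f v = f v.
Proof.
move=> lf v; pose F : {linear V -> W} :=
  HB.pack f (GRing.isLinear.Build _ _ _ _ _ lf).
exact: (lfunE F v).
Qed.

Section Bracket.
Context {R : realType} {n : nat} (G : lieGroupType R n).
Local Notation g := 'rV[R]_n.
Local Notation gdual := (lieDual R n).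
Implicit Types (x y z : g) (m : gdual).

Lemma lie_bracketC x y : lie_bracket G x y = - lie_bracket G y x.
Proof. exact: vbracketN. Qed.

(** Linearity is visible on the derivative of [a |-> Ad(a^-1) x], which the bracket
    is by [tder_Ad_inv]. *)
Lemma lie_bracket_linear x : linear (lie_bracket G x).
Proof.
move=> k y z; rewrite -!tder_Ad_inv.
exact: (tder_linear (smooth_Ad_inv G x) k y z).
Qed.
HB.instance Definition _ x :=
  GRing.isLinear.Build R g g _ (lie_bracket G x) (lie_bracket_linear x).

Lemma lie_bracket0l x : lie_bracket G 0 x = 0.
Proof. by apply: (eq_trans (lie_bracketC _ _)); rewrite linear0 oppr0. Qed.

Lemma lie_bracket_linearl z : linear (lie_bracket G ^~ z).
Proof.
move=> k x y; apply: (eq_trans (lie_bracketC _ _)).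
apply: (eq_trans (congr1 -%R (lie_bracket_linear z k x y))).
rewrite opprD -scalerN.
by congr (_ *: _ + _); apply: esym; exact: lie_bracketC.
Qed.

Lemma dual_bracketE m x y : dual_bracket G m x y = m (lie_bracket G x y).
Proof.
rewrite /dual_bracket linfunE// => k u v; rewrite !linearP //.
Qed.

Lemma ad_dualE m x y : ad_dual G m x y = m (lie_bracket G x y).
Proof.
suff l : linear (dual_bracket G m).
  exact: (eq_trans (congr1 (fun f : gdual => f y) (linfunE l x)) (dual_bracketE m x y)).
move=> k u v; apply/lfunP => z.
have e1 : m (lie_bracket G (k *: u + v) z) =
    k *: m (lie_bracket G u z) + m (lie_bracket G v z).
  by rewrite (lie_bracket_linearl z k u v) linearP.
apply: (eq_trans (dual_bracketE _ _ _)); apply: (eq_trans e1); apply: esym.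
apply: (eq_trans (add_lfunE _ _ _)); congr (_ + _); last exact: dual_bracketE.
apply: (eq_trans (scale_lfunE _ _ _)); congr (_ *: _); exact: dual_bracketE.
Qed.
End Bracket.

(** In this section [S] stands for [Phi^-1], [B x y] for [<mu,[x,y]>] and [A] for
    [ad mu \o Phi]. *)
Section PointwiseAlgebra.
Context {R : realType} {n : nat}.
Local Notation g := 'rV[R]_n.
Local Notation gdual := (lieDual R n).
Implicit Types (x y z u : g) (m : gdual).
Variables (Phi : 'Hom(gdual, g)) (S : g -> gdual) (A : gdual -> gdual) (B : g -> g -> R).
Hypotheses (S_Phi : forall m, S (Phi m) = m) (Phi_S : forall y, Phi (S y) = y)
  (B_anti : forall x y, B x y = - B y x)
  (AE : forall m z, A m z = B (Phi m) z).

Let Sadd y z : S (y + z) = S y + S z.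
Proof. by rewrite -[y in LHS]Phi_S -[z in LHS]Phi_S -linearD S_Phi. Qed.

Let S0 : S 0 = 0. Proof. by rewrite -[0 in LHS](linear0 Phi) S_Phi. Qed.

Let Sopp y : S (- y) = - S y.
Proof. by rewrite -[y in LHS]Phi_S -linearN S_Phi. Qed.

Lemma Phi_symmetricP : dual_symmetric Phi <-> forall x y, S x y = S y x.
Proof.
split=> H x y; last by rewrite -{1}(S_Phi x) -{2}(S_Phi y) H.
by have := H (S x) (S y); rewrite !Phi_S.
Qed.

Hypothesis Phi_sym : dual_symmetric Phi.
Let Ssym := (Phi_symmetricP.1 Phi_sym).

Lemma PhiAA m : m (Phi (A (A m))) = - A m (Phi (A m)).
Proof. by rewrite Phi_sym AE B_anti -AE. Qed.

(** The candidate metric at the pair of equal vectors [u^# + I y^#]. *)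
Definition block_form u y : R := S u u + S y y + B y u *+ 2.

(** The vector [u = - Phi (A m)] minimises [block_form u (Phi m)]. *)
Lemma block_form_min m : block_form (- Phi (A m)) (Phi m) = m (Phi m) + m (Phi (A (A m))).
Proof.
rewrite /block_form Sopp !S_Phi PhiAA -AE opp_lfunE !linearN /=.
have aux (a b : R) : - - a + b + - a *+ 2 = b + - a by rewrite mulr2n; ring.
exact: aux.
Qed.

Lemma block_form_square u m :
  block_form u (Phi m) = S (u + Phi (A m)) (u + Phi (A m)) + (m (Phi m) + m (Phi (A (A m)))).
Proof.
rewrite /block_form Sadd !S_Phi PhiAA -AE !add_lfunE !linearD /=.
rewrite (Ssym u (Phi (A m))) S_Phi.
have aux (a b c d : R) : a + b + d *+ 2 = a + d + (d + c) + (b + - c).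
  by rewrite mulr2n; ring.
exact: aux.
Qed.

Lemma block_form_posdef :
  (forall u y, (u, y) != 0 -> 0 < block_form u y) <->
  dual_posdef Phi /\ (forall m : gdual, m != 0 -> 0 < m (Phi m) + m (Phi (A (A m)))).
Proof.
split=> [H|[H1 H2] u y uy].
  split=> m m0.
    have Pm0 : (Phi m, 0 : g) != 0.
      apply: contraNneq m0 => -[e]; by rewrite -(S_Phi m) e S0.
    have := H _ _ Pm0; rewrite /block_form S0 S_Phi B_anti.
    have -> : B (Phi m) 0 = 0 by rewrite -AE linear0.
    by rewrite lfunE /= oppr0 mul0rn !addr0.
  rewrite -block_form_min; apply: H; apply: contraNneq m0 => -[_ e].
  by rewrite -(S_Phi m) e S0.
have Spos z : 0 <= S z z.
  have [->|z0] := eqVneq z 0; first by rewrite linear0.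
  rewrite -[X in S X X]Phi_S; rewrite S_Phi; apply/ltW/H1.
  by apply: contraNneq z0 => e; rewrite -(Phi_S z) e linear0.
rewrite -(Phi_S y) block_form_square; set m := S y.
have [m0|m0] := eqVneq m 0; last first.
  by rewrite ltr_wpDl// ?Spos//; exact: H2.
have y0 : y = 0 by rewrite -(Phi_S y) -/m m0 linear0.
have A0 : A m = 0.
  apply/lfunP => z; rewrite AE m0 linear0 B_anti zero_lfunE.
  rewrite -(Phi_S z) -AE linear0 oppr0 //.
rewrite A0 m0 !linear0 addr0 zero_lfunE addr0.
have u0 : S u != 0.
  apply: contraNneq uy => e; rewrite y0 -(Phi_S u) e linear0 //.
by have := H1 _ u0; rewrite Phi_S ?addr0.
Qed.
End PointwiseAlgebra.

(** * Moment maps on the bundle *)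
Section Main.
Context {R : realType} {n : nat} (G : lieGroupType R n).
Local Notation g := 'rV[R]_n.
Local Notation gdual := (lieDual R n).
Local Notation TP := ('rV[R]_n * 'rV[R]_n)%type.
Local Notation P := (G * 'rV[R]_n)%type.
Local Notation atP := (bundle_atlas G : atlas TP P).
Local Notation sP := (bundle_smooth_atlas G).
Implicit Types (a b : G) (x y z : g) (m : gdual) (p q : P) (v w : TP).

Variables (I : P -> {linear TP -> TP}) (theta L : P -> {linear TP -> g})
  (mu : P -> gdual).
Hypotheses (I_complex : complex_structure atP I)
  (I_invariant : @invariant_endo R n G I)
  (I_decomposition : forall p v, exists! xy : g * g,
     v = fund xy.1 p + I p (fund xy.2 p))
  (theta_def : forall p x y, theta p (fund x p + I p (fund y p)) = x)
  (L_def : forall p x y, L p (fund x p + I p (fund y p)) = y)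
  (mu_smooth : @smooth_dual R n G mu)
  (mu_equivariant : @coadjoint_equivariant R n G mu).

Let splitP := splitE I_decomposition theta_def L_def.
Let thI := theta_I I_complex I_decomposition theta_def L_def.
Let LI := L_I I_complex I_decomposition theta_def L_def.
Let thf := theta_fund theta_def.
Let Lf := L_fund L_def.
Let thIf := theta_Ifund theta_def.
Let LIf := L_Ifund L_def.
Let I2 := I_square I_complex.

Definition dmu x p v : R := tder atP p v (fun q => mu q x : R).

Let sm x p : smooth_at atP (fun q => mu q x : R) p. Proof. exact: mu_smooth. Qed.

Fact dmu_linear x p : linear (dmu x p : TP -> R).
Proof. exact: tder_linear (sm x p). Qed.
HB.instance Definition _ x p := GRing.isLinear.Build R TP R _ (dmu x p) (dmu_linear x p).

Fact dmu_linearl p v : linear (fun x => dmu x p v : R).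
Proof.
move=> k x y; rewrite /dmu.
have e : (fun q => mu q (k *: x + y) : R) = (fun q => k * mu q x + mu q y).
  by apply/funext => q; rewrite linearP.
apply: (eq_trans (congr1 (tder atP p v) e)).
have skx : smooth_at atP (fun q => k * mu q x : R) p.
  by apply: smooth_nearM; [exact: smooth_near_cst|exact: sm].
apply: (eq_trans (tderD _ skx (sm y p))); congr (_ + _).
have sk : smooth_at atP (fun=> k : R) p by exact: smooth_near_cst.
apply: (eq_trans (tderM sP _ sk (sm x p))).
by rewrite tder_cst mulr0 addr0.
Qed.
Definition dmu_at p v : g -> R := fun x => dmu x p v.
HB.instance Definition _ p v := GRing.isLinear.Build R g R _ (dmu_at p v) (dmu_linearl p v).

Lemma dmu_fund x p y : dmu x p (fund y p) = mu p (lie_bracket G x y).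
Proof. exact: tder_fund_equivariant mu_smooth mu_equivariant. Qed.

(** The covariant derivative along [I y^#]; it is the inverse of [Phi], see
    [Phi_Dmu_I] and [Dmu_I_Phi]. *)
Definition Dmu_I p y : gdual := cov_der theta mu p (I p (fund y p)).

Lemma cov_derE p v x :
  cov_der theta mu p v x = dmu x p v + mu p (lie_bracket G (theta p v) x).
Proof.
apply: (eq_trans (add_lfunE _ _ _)); congr (_ + _); last exact: dual_bracketE.
by rewrite linfunE//; exact: dmu_linearl.
Qed.

Lemma Dmu_IE p y x : Dmu_I p y x = dmu x p (I p (fund y p)).
Proof.
apply: (eq_trans (cov_derE _ _ _)); rewrite thIf.
rewrite lie_bracket0l.
by rewrite linear0 addr0.
Qed.

Lemma dmu_split x p v :
  dmu x p v = mu p (lie_bracket G x (theta p v)) + Dmu_I p (L p v) x.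
Proof.
apply: (eq_trans (congr1 (dmu x p) (splitP p v))).
apply: (eq_trans (linearD (dmu x p) _ _)).
by congr (_ + _); [exact: dmu_fund|exact: esym (Dmu_IE _ _ _)].
Qed.

Lemma dmu_split_I x p v :
  dmu x p (I p v) = Dmu_I p (theta p v) x - mu p (lie_bracket G x (L p v)).
Proof.
apply: (eq_trans (dmu_split _ _ _)); rewrite thI LI addrC; congr (_ + _).
by rewrite !linearN.
Qed.

Lemma cov_der_split p v : cov_der theta mu p v = Dmu_I p (L p v).
Proof.
apply/lfunP => x; apply: (eq_trans (cov_derE _ _ _)).
rewrite dmu_split; have -> : lie_bracket G (theta p v) x = - lie_bracket G x (theta p v).
  exact: lie_bracketC.
by rewrite linearN /= addrAC subrr add0r.
Qed.

(** The only hermitian form for which [mu] can be a moment map: split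
    [v = theta(v)^# + I L(v)^#] and use [h(x^#, w) = h(I x^#, I w)]. *)
Definition moment_metric p v w : R := dmu (theta p v) p (I p w) + dmu (L p v) p w.

Lemma moment_metric_unique (h : P -> TP -> TP -> R) :
  kahler_metric atP I h -> @moment_map R n G I h mu ->
  forall p v w, h p v w = moment_metric p v w.
Proof.
move=> [[hl hs _ _] hI _] hm p v w.
have hD u u' w' : h p (u + u') w' = h p u w' + h p u' w'.
  by have := hl p 1 u u' w'; rewrite scale1r mul1r.
rewrite [v in LHS](splitP p v) hD /moment_metric; congr (_ + _).
  by rewrite -hI; apply: esym; exact: hm.
by apply: esym; exact: hm.
Qed.

Lemma moment_metric_moment_map : @moment_map R n G I moment_metric mu.
Proof.
move=> x p v; rewrite /kahler_form /moment_metric thIf LIf.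
rewrite -[dmu 0 p _]/(dmu_at p _ 0) linear0 add0r //.
Qed.

Lemma moment_metric_hermitian p v w :
  moment_metric p (I p v) (I p w) = moment_metric p v w.
Proof.
rewrite /moment_metric thI LI I2 addrC; congr (_ + _).
apply: (eq_trans (linearN (dmu_at p (- w)) (L p v))).
exact: (eq_trans (congr1 -%R (linearN (dmu (L p v) p) w)) (opprK _)).
Qed.

Lemma moment_metric_invariant : @invariant_metric R n G moment_metric.
Proof.
move=> a p v w.
have e : act_push a p v = fund (Ad a (theta p v)) (bundle_act a p)
      + I (bundle_act a p) (fund (Ad a (L p v)) (bundle_act a p)).
  apply: (eq_trans (congr1 (act_push a p) (splitP p v))).
  have l u u' : act_push a p (u + u') = act_push a p u + act_push a p u' :> TP.
    by have := act_push_linear a p 1 u u'; rewrite !scale1r.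
  apply: (eq_trans (l (fund (theta p v) p) (I p (fund (L p v) p)))).
  apply: (f_equal2 (fun u u' : TP => u + u')).
    exact: (act_push_fund a (theta p v) p).
  apply: (eq_trans (esym (I_invariant a p (fund (L p v) p)))).
  exact: (congr1 (I (bundle_act a p)) (act_push_fund a (L p v) p)).
have de x u : dmu (Ad a x) (bundle_act a p) (act_push a p u) = dmu x p u.
  apply: (eq_trans (tder_act_push _ (sm (Ad a x) (bundle_act a p)))).
  apply: (congr1 (tder atP p u)); apply/funext => q.
  by rewrite (mu_equivariant a q) AdK.
have et : theta (bundle_act a p) (act_push a p v) = Ad a (theta p v).
  exact: (eq_trans (congr1 (theta _) e) (theta_def _ _ _)).
have el : L (bundle_act a p) (act_push a p v) = Ad a (L p v).
  exact: (eq_trans (congr1 (L _) e) (L_def _ _ _)).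
rewrite /moment_metric (I_invariant a p w) et el.
by congr (_ + _); exact: de.
Qed.

Lemma moment_metric_split p v w : moment_metric p v w =
   Dmu_I p (theta p w) (theta p v) + Dmu_I p (L p w) (L p v)
   + mu p (lie_bracket G (L p v) (theta p w) - lie_bracket G (theta p v) (L p w)).
Proof.
have aux (a b c d : R) : a - b + (c + d) = a + d + (c - b) by ring.
apply: (eq_trans (f_equal2 (fun u v : R => u + v) (dmu_split_I _ _ _) (dmu_split _ _ _))).
apply: (eq_trans (aux _ _ _ _)).
apply: (congr1 (fun u : R => _ + u)).
exact: esym (linearB (mu p) _ _).
Qed.

Lemma vbracket_fund_fund x y p :
  vbracket atP (fund x) (fund y) p = - fund (lie_bracket G x y) p.
Proof.
apply: (vbracket_fund (W := fun q => fund_at q)) => [a q z|z]; first exact: fund_act.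
exact: smooth_fund.
Qed.

Definition Ifund_at p : g -> TP := fun x => I p (fund x p).
Fact Ifund_at_linear p : linear (Ifund_at p).
Proof. exact: (linearP (I p \o fund_at p)). Qed.
HB.instance Definition _ p := GRing.isLinear.Build R g TP _ (Ifund_at p) (Ifund_at_linear p).

Lemma Ifund_act a z q :
  Ifund_at (bundle_act a q) z = act_push a q (Ifund_at q (Ad a^-1%g z)) :> TP.
Proof.
pose proof (congr1 (I (bundle_act a q)) (fund_act a z q)) as e1.
pose proof (I_invariant a q (fund (Ad a^-1%g z) q)) as e2.
exact: (eq_trans e1 e2).
Qed.

Lemma vbracket_fund_Ifund x y p :
  vbracket atP (fund x) (fun q => I q (fund y q)) p = - I p (fund (lie_bracket G x y) p).
Proof.
apply: (vbracket_fund (W := fun q => Ifund_at q)) => [a q z|z].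
  exact: Ifund_act.
exact: (smooth_Ifund I_complex z).
Qed.

Lemma vbracket_Ifund_fund x y p :
  vbracket atP (fun q => I q (fund x q)) (fund y) p = - I p (fund (lie_bracket G x y) p).
Proof.
apply: (eq_trans (vbracketN _ _ _ _)).
apply: (eq_trans (congr1 -%R (vbracket_fund_Ifund y x p))); rewrite opprK.
have -> : lie_bracket G y x = - lie_bracket G x y by exact: lie_bracketC.
exact: (linearN (Ifund_at p)).
Qed.

(** The Nijenhuis tensor on [x^#], [y^#] is [[I x^#,I y^#] - [x,y]^#]: the two mixed
    brackets contribute [- 2 [x,y]^#] and [[x^#,y^#]] contributes [[x,y]^#]. *)
Lemma vbracket_Ifund_Ifund x y p :
  vbracket atP (fun q => I q (fund x q)) (fun q => I q (fund y q)) p =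
    fund (lie_bracket G x y) p.
Proof.
have [_ _ nij] := I_complex.
have := nij _ _ (smooth_fund x) (smooth_fund y) p.
have e1 : I p (vbracket atP (app_vfield I (fund x)) (fund y) p) = fund (lie_bracket G x y) p.
  apply: (eq_trans (congr1 (I p) (vbracket_Ifund_fund x y p))).
  by rewrite linearN I2 opprK.
have e2 : I p (vbracket atP (fund x) (app_vfield I (fund y)) p) = fund (lie_bracket G x y) p.
  apply: (eq_trans (congr1 (I p) (vbracket_fund_Ifund x y p))).
  by rewrite linearN I2 opprK.
have aux (u f1 f2 f3 f : TP) : f1 = f -> f2 = f -> f3 = - f -> u - f1 - f2 - f3 = 0 -> u = f.
  by move=> -> -> ->; rewrite opprK subrK => /subr0_eq.
exact: (aux _ _ _ _ _ e1 e2 (vbracket_fund_fund x y p)).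
Qed.

Definition moment_form q v : R := mu q (theta q v).

Lemma moment_form_linear q : linear (moment_form q : TP -> R).
Proof. by move=> k u v; rewrite /moment_form !linearP. Qed.

Lemma moment_form_smooth (X : P -> TP) p : smooth_vfield atP X ->
  smooth_at atP (fun q => moment_form q (X q) : R) p.
Proof.
move=> sX.
have -> : (fun q => moment_form q (X q) : R) =
    (fun q => \sum_i theta q (X q) 0 i * mu q (delta_mx 0 i)).
  apply/funext => q; rewrite /moment_form [theta q (X q) in LHS]row_sum_delta linear_sum.
  by apply: eq_bigr => i _; rewrite linearZ.
apply: smooth_near_sum => i; apply: smooth_nearM; last exact: sm.
exact: (smooth_theta I_complex I_decomposition theta_def L_def).
Qed.

Lemma moment_form_fund q x : moment_form q (fund x q) = mu q x.
Proof. by rewrite /moment_form thf. Qed.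

Lemma moment_form_Ifund q x : moment_form q (I q (fund x q)) = 0.
Proof. by rewrite /moment_form thIf linear0. Qed.

Let omega := kahler_form I moment_metric.

Lemma omega_fund x p v : omega p (fund x p) v = dmu x p v.
Proof. exact: esym (moment_metric_moment_map x p v). Qed.

Lemma omega_Ifund x p v : omega p (I p (fund x p)) v = - dmu x p (I p v).
Proof.
rewrite /omega /kahler_form /moment_metric I2 !linearN thf Lf oppr0.
have d0 w : dmu 0 p w = 0 by exact: (linear0 (dmu_at p w)).
by rewrite d0 addr0; exact: (linearN (dmu_at p (I p v)) x).
Qed.

Let tder_moment_form_fund x p v : tder atP p v (fun q => moment_form q (fund x q) : R) = dmu x p v.
Proof.
apply: (congr1 (tder atP p v)); apply/funext => q; exact: moment_form_fund.
Qed.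

Let tder_moment_form_Ifund x p v : tder atP p v (fun q => moment_form q (I q (fund x q)) : R) = 0.
Proof.
have e : (fun q => moment_form q (I q (fund x q)) : R) = (fun=> 0).
  by apply/funext => q; exact: moment_form_Ifund.
exact: (eq_trans (congr1 (tder atP p v) e) (tder_cst _ _ _ _)).
Qed.

Let muC p x y : mu p (lie_bracket G x y) = - mu p (lie_bracket G y x).
Proof.
have -> : lie_bracket G x y = - lie_bracket G y x by exact: lie_bracketC.
exact: linearN.
Qed.

Let d1_aux (t1 t2 t3 r1 r2 r3 : R) : t1 = r1 -> t2 = r2 -> t3 = r3 ->
  t1 - t2 - t3 = r1 - r2 - r3.
Proof. by move=> -> -> ->. Qed.

Lemma moment_form_opp_fund p z : moment_form p (- fund z p) = - mu p z.
Proof. by rewrite /moment_form linearN thf linearN. Qed.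

Lemma moment_form_opp_Ifund p z : moment_form p (- I p (fund z p)) = 0.
Proof. by rewrite /moment_form linearN thIf oppr0 linear0. Qed.

Lemma omega_fund_fund x y p :
  omega p (fund x p) (fund y p) = - d1 atP moment_form (fund x) (fund y) p.
Proof.
apply: (eq_trans (omega_fund x p _)); apply: (eq_trans (dmu_fund x p y)).
have e : d1 atP moment_form (fund x) (fund y) p =
    mu p (lie_bracket G y x) - mu p (lie_bracket G x y) - - mu p (lie_bracket G x y).
  apply: d1_aux.
  - exact: (eq_trans (tder_moment_form_fund _ _ _) (dmu_fund _ _ _)).
  - exact: (eq_trans (tder_moment_form_fund _ _ _) (dmu_fund _ _ _)).
  - exact: (eq_trans (congr1 (moment_form p) (vbracket_fund_fund x y p)) (moment_form_opp_fund _ _)).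
have aux (b c d : R) : d = b - c - - c -> c = - b -> c = - d.
  by move=> -> ->; ring.
exact: (aux _ _ _ e (muC p x y)).
Qed.

Lemma omega_fund_Ifund x y p :
  omega p (fund x p) (I p (fund y p)) =
    - d1 atP moment_form (fund x) (fun q => I q (fund y q)) p.
Proof.
apply: (eq_trans (omega_fund x p _)).
have e : d1 atP moment_form (fund x) (fun q => I q (fund y q)) p =
    0 - dmu x p (I p (fund y p)) - 0.
  apply: d1_aux; [exact: tder_moment_form_Ifund|exact: tder_moment_form_fund|].
  exact: (eq_trans (congr1 (moment_form p) (vbracket_fund_Ifund x y p)) (moment_form_opp_Ifund _ _)).
have aux (c d : R) : d = 0 - c - 0 -> c = - d by move=> ->; ring.
exact: (aux _ _ e).
Qed.

Lemma omega_Ifund_fund x y p : Dmu_I p x y = Dmu_I p y x ->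
  omega p (I p (fund x p)) (fund y p) =
    - d1 atP moment_form (fun q => I q (fund x q)) (fund y) p.
Proof.
move=> sxy; apply: (eq_trans (omega_Ifund x p _)).
have e : d1 atP moment_form (fun q => I q (fund x q)) (fund y) p =
    dmu y p (I p (fund x p)) - 0 - 0.
  apply: d1_aux; [exact: tder_moment_form_fund|exact: tder_moment_form_Ifund|].
  exact: (eq_trans (congr1 (moment_form p) (vbracket_Ifund_fund x y p)) (moment_form_opp_Ifund _ _)).
have aux (b c d : R) : d = b - 0 - 0 -> b = c -> - c = - d by move=> -> ->; ring.
apply: (aux _ _ _ e); apply: (eq_trans (esym (Dmu_IE p x y))).
exact: (eq_trans sxy (Dmu_IE p y x)).
Qed.

Lemma omega_Ifund_Ifund x y p :
  omega p (I p (fund x p)) (I p (fund y p)) =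
    - d1 atP moment_form (fun q => I q (fund x q)) (fun q => I q (fund y q)) p.
Proof.
apply: (eq_trans (omega_Ifund x p _)).
have e : d1 atP moment_form (fun q => I q (fund x q)) (fun q => I q (fund y q)) p =
    0 - 0 - mu p (lie_bracket G x y).
  apply: d1_aux; [exact: tder_moment_form_Ifund|exact: tder_moment_form_Ifund|].
  exact: (eq_trans (congr1 (moment_form p) (vbracket_Ifund_Ifund x y p)) (moment_form_fund _ _)).
have aux (b c d : R) : d = 0 - 0 - c -> b = c -> b = - d by move=> -> ->; ring.
apply: (aux _ _ _ e).
apply: (eq_trans (congr1 -%R (congr1 (dmu x p) (I2 p (fund y p))))).
apply: (eq_trans (congr1 -%R (linearN (dmu x p) (fund y p)))).
by apply: (eq_trans (opprK _)); exact: dmu_fund.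
Qed.

Lemma omega_linearr p v : linear (omega p v : TP -> R).
Proof.
move=> k w w'; rewrite /omega /kahler_form /moment_metric.
have -> : I p (k *: w + w') = k *: I p w + I p w' by rewrite linearP.
apply: (eq_trans (f_equal2 (fun u u' : R => u + u')
  (dmu_linear _ p k _ _) (dmu_linear _ p k _ _))).
have aux (a b c d : R) : k *: a + b + (k *: c + d) = k *: (a + c) + (b + d).
  by rewrite scalerDr addrACA.
exact: aux.
Qed.

Lemma moment_metric_linearl p w : linear (fun v => moment_metric p v w : R).
Proof.
move=> k v v'; rewrite /moment_metric.
have -> : theta p (k *: v + v') = k *: theta p v + theta p v' by rewrite linearP.
have -> : L p (k *: v + v') = k *: L p v + L p v' by rewrite linearP.
apply: (eq_trans (f_equal2 (fun u u' : R => u + u')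
  (dmu_linearl p _ k _ _) (dmu_linearl p _ k _ _))).
have aux (a b c d : R) : k *: a + b + (k *: c + d) = k *: (a + c) + (b + d).
  by rewrite scalerDr addrACA.
exact: aux.
Qed.

Lemma omega_linearl p w : linear (fun v => omega p v w : R).
Proof.
move=> k v v'; rewrite /omega /kahler_form.
have -> : I p (k *: v + v') = k *: I p v + I p v' by rewrite linearP.
exact: moment_metric_linearl.
Qed.

Section SymmetricPotential.
Hypothesis Dmu_I_sym : forall p x y, Dmu_I p x y = Dmu_I p y x.

(** The four values on the frame agree; on [(I x^#, y^#)] they are
    [- <Phi^-1 y, x>] and [- <Phi^-1 x, y>], equal by the symmetry of [Phi]. *)
Lemma omega_d1 (X Y : P -> TP) p : smooth_vfield atP X -> smooth_vfield atP Y ->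
  omega p (X p) (Y p) = - d1 atP moment_form X Y p.
Proof.
move=> sX sY.
have eX : X = (fun q => \sum_k split_row theta L q (X q) 0 k *: split_frame I k q).
  by apply/funext => q; exact: (split_rowE I_decomposition theta_def L_def).
have eY : Y = (fun q => \sum_k split_row theta L q (Y q) 0 k *: split_frame I k q).
  by apply/funext => q; exact: (split_rowE I_decomposition theta_def L_def).
rewrite eX eY.
apply: (d1_on_frame sP moment_form_linear moment_form_smooth (smooth_split_frame I_complex)
  (w := omega p)
  (a := fun k q => split_row theta L q (X q) 0 k)
  (b := fun k q => split_row theta L q (Y q) 0 k)).
- exact: omega_linearr.
- exact: omega_linearl.
- move=> k l; rewrite /split_frame.
  case: (fintype.split k) => i; case: (fintype.split l) => j.
  + exact: omega_fund_fund.
  + exact: omega_fund_Ifund.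
  + exact: omega_Ifund_fund.
  + exact: omega_Ifund_Ifund.
- by move=> k q; exact: (smooth_split_row I_complex I_decomposition theta_def L_def).
- by move=> k q; exact: (smooth_split_row I_complex I_decomposition theta_def L_def).
Qed.

(** [g(X,Y) = - omega(I X,Y)] is the exterior derivative of the smooth form
    [<mu,theta>] on smooth fields. *)
Lemma moment_metric_smooth (X Y : P -> TP) p : smooth_vfield atP X -> smooth_vfield atP Y ->
  smooth_at atP (fun q => moment_metric q (X q) (Y q) : R) p.
Proof.
move=> sX sY.
have sIX : smooth_vfield atP (app_vfield I X) by case: I_complex => sI _ _; exact: sI.
have -> : (fun q => moment_metric q (X q) (Y q) : R) =
    (fun q => d1 atP moment_form (app_vfield I X) Y q).
  apply/funext => q; rewrite -[RHS]opprK -omega_d1// /omega /kahler_form /app_vfield I2.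
  pose M : {linear TP -> R} := HB.pack (fun v => moment_metric q v (Y q))
    (GRing.isLinear.Build _ _ _ _ _ (moment_metric_linearl q (Y q))).
  by rewrite -[LHS]opprK; congr (- _); exact: esym (linearN M (X q)).
apply: smooth_nearD; last first.
  by apply: smooth_nearN; apply: moment_form_smooth; exact: (smooth_vbracket sP sIX sY).
apply: smooth_nearD; last apply: smooth_nearN.
  by apply: (smooth_at_tder sP sIX); exact: moment_form_smooth.
by apply: (smooth_at_tder sP sY); exact: moment_form_smooth.
Qed.

Lemma omega_closed (X Y Z : P -> TP) p :
  smooth_vfield atP X -> smooth_vfield atP Y -> smooth_vfield atP Z ->
  d2 atP omega X Y Z p = 0.
Proof.
by apply: (d2_d1 sP moment_form_linear moment_form_smooth) => U V q; exact: omega_d1.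
Qed.
End SymmetricPotential.

Section Phi.
Variable Phi : P -> 'Hom(gdual, g).
Hypotheses (mu_regular : regular theta mu)
  (Phi_def : forall p v, L p v = Phi p (cov_der theta mu p v)).

Lemma Phi_Dmu_I p y : Phi p (Dmu_I p y) = y.
Proof. by rewrite -Phi_def LIf. Qed.

(** This is where regularity is used: [m] is [D mu] of some horizontal vector,
    and horizontal vectors are the [I y^#]. *)
Lemma Dmu_I_Phi p m : Dmu_I p (Phi p m) = m.
Proof.
have [v [[v1 v2] _]] := mu_regular p m.
by rewrite -[in LHS]v2 -Phi_def -cov_der_split.
Qed.

Lemma Phi_inv p y : (Phi p)^-1%VF y = Dmu_I p y.
Proof.
rewrite -[y in LHS](Phi_Dmu_I p) lker0_lfunK//; apply/lker0P => m1 m2 e.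
by rewrite -(Dmu_I_Phi p m1) e Dmu_I_Phi.
Qed.

Definition Phi_conditions p : Prop := let A := (ad_dual G (mu p) \o Phi p)%VF in
  [/\ dual_symmetric (Phi p), dual_posdef (Phi p)
        & dual_posdef (Phi p + (Phi p \o (A \o A))%VF)].

Let B p x y : R := mu p (lie_bracket G x y).
Let A p : gdual -> gdual := (ad_dual G (mu p) \o Phi p)%VF.
Let B_anti p x y : B p x y = - B p y x.
Proof.
rewrite /B; have -> : lie_bracket G x y = - lie_bracket G y x by exact: lie_bracketC.
by rewrite linearN.
Qed.
Let AE p m z : A p m z = B p (Phi p m) z.
Proof. by rewrite /A comp_lfunE ad_dualE. Qed.

Lemma Phi_conditionsP p : Phi_conditions p <-> (forall x y, Dmu_I p x y = Dmu_I p y x) /\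
   (forall u y, (u, y) != 0 -> 0 < block_form (Dmu_I p) (B p) u y).
Proof.
have sp := Phi_symmetricP (Dmu_I_Phi p) (Phi_Dmu_I p).
have eA m : m ((Phi p + (Phi p \o ((ad_dual G (mu p) \o Phi p) \o (ad_dual G (mu p) \o Phi p)))%VF) m) =
    m (Phi p m) + m (Phi p (A p (A p m))).
  by rewrite add_lfunE linearD /= /A !comp_lfunE.
have bp sym := @block_form_posdef R n (Phi p) (Dmu_I p) (A p) (B p) (Dmu_I_Phi p) (Phi_Dmu_I p) (@B_anti p) (@AE p) sym.
split=> [[c1 c2 c3]|[s H]].
  split; first exact/sp.
  by apply/(bp c1); split=> // m m0; rewrite -eA; exact: c3.
have c1 := sp.2 s; have [c2 c3] := (bp c1).1 H.
by split=> // m m0; rewrite eA; exact: c3.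
Qed.

Lemma moment_metric_block p v : moment_metric p v v =
  block_form (Dmu_I p) (B p) (theta p v) (L p v).
Proof.
apply: (eq_trans (moment_metric_split _ _ _)); apply: (congr1 (fun u : R => _ + u)).
apply: (eq_trans (linearB (mu p) _ _)).
apply: (eq_trans (congr1 (fun u : R => _ - u) (B_anti p (theta p v) (L p v)))).
by rewrite opprK mulr2n.
Qed.

Lemma moment_metric_fund p x y : moment_metric p (fund x p) (fund y p) = Dmu_I p y x.
Proof.
rewrite /moment_metric thf Lf.
have d0 w : dmu 0 p w = 0 by exact: (linear0 (dmu_at p w)).
by rewrite d0 addr0; exact: esym (Dmu_IE p y x).
Qed.

(** On the vertical vectors [h] is [Phi^-1], and on
    pairs of equal vectors it is [block_form]. *)
Lemma kahler_necessary h : kahler_metric atP I h -> @moment_map R n G I h mu ->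
  forall p, Phi_conditions p.
Proof.
move=> hK hm p; apply/Phi_conditionsP.
have hE := moment_metric_unique hK hm p.
have [[_ hs hpos _] _ _] := hK.
split=> [x y|u y uy].
  apply: (eq_trans (esym (moment_metric_fund p y x))).
  apply: (eq_trans (esym (hE _ _))); apply: (eq_trans (hs _ _ _)).
  exact: (eq_trans (hE _ _) (moment_metric_fund p x y)).
pose v := fund u p + I p (fund y p).
have v0 : v != 0.
  apply: contraNneq uy => v0; apply/eqP.
  have ev : u = 0 by rewrite -(theta_def p u y) -/v v0 linear0.
  have ew : y = 0 by rewrite -(L_def p u y) -/v v0 linear0.
  by rewrite ev ew.
have := hpos p v v0; rewrite hE moment_metric_block.
by rewrite theta_def L_def.
Qed.

Lemma moment_metric_kahler : (forall p, Phi_conditions p) -> kahler_metric atP I moment_metric.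
Proof.
move=> H.
have sym p x y := (proj1 (Phi_conditionsP p) (H p)).1 x y.
have pos p := (proj1 (Phi_conditionsP p) (H p)).2.
split; last 2 first.
- exact: moment_metric_hermitian.
- move=> X Y Z sX sY sZ p; exact: omega_closed.
split.
- move=> p k u v w; exact: moment_metric_linearl.
- move=> p v w; apply: (eq_trans (moment_metric_split _ _ _)).
  apply: esym; apply: (eq_trans (moment_metric_split _ _ _)).
  apply: (f_equal2 (fun a b : R => a + b)).
    by apply: (f_equal2 (fun a b : R => a + b)); exact: sym.
  have e1 : lie_bracket G (L p w) (theta p v) = - lie_bracket G (theta p v) (L p w).
    exact: lie_bracketC.
  have e2 : lie_bracket G (theta p w) (L p v) = - lie_bracket G (L p v) (theta p w).
    exact: lie_bracketC.
  by rewrite e1 e2 opprK addrC.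
- move=> p v v0; rewrite moment_metric_block; apply: pos.
  apply: contraNneq v0 => -[et el].
  by rewrite (splitP p v) et el fund0 linear0 addr0.
- move=> X Y sX sY p; exact: moment_metric_smooth.
Qed.

Lemma moment_metric_formula p v w : Phi_conditions p ->
  let Dmu := cov_der theta mu p in
  moment_metric p v w = Dmu w (Phi p (Dmu v)) + ((Phi p)^-1)%VF (theta p v) (theta p w)
    + mu p (lie_bracket G (Phi p (Dmu v)) (theta p w)
            - lie_bracket G (theta p v) (Phi p (Dmu w))).
Proof.
move=> /Phi_conditionsP[sym _] Dmu; apply: (eq_trans (moment_metric_split _ _ _)).
have e1 u : Phi p (Dmu u) = L p u := esym (Phi_def p u).
have e2 : Dmu w (Phi p (Dmu v)) = Dmu_I p (L p w) (L p v).
  apply: (eq_trans (congr1 (Dmu w) (e1 v))).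
  exact: (congr1 (fun f : gdual => f (L p v)) (cov_der_split p w)).
have e3 : ((Phi p)^-1)%VF (theta p v) (theta p w) = Dmu_I p (theta p w) (theta p v).
  apply: eq_trans (sym _ _).
  exact: (congr1 (fun f : gdual => f (theta p w)) (Phi_inv p (theta p v))).
have e4 := f_equal2
   (fun x y => mu p (lie_bracket G x (theta p w) - lie_bracket G (theta p v) y))
   (e1 v) (e1 w).
have aux (a b c a' b' c' : R) : a = a' -> b = b' -> c = c' -> b' + a' + c' = a + b + c.
  by move=> -> -> ->; rewrite (addrC b').
exact: (aux _ _ _ _ _ _ e2 e3 e4).
Qed.

Lemma kahler_form_d1 h (X Y : P -> TP) p :
  kahler_metric atP I h -> @moment_map R n G I h mu ->
  smooth_vfield atP X -> smooth_vfield atP Y ->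
  kahler_form I h p (X p) (Y p) = - d1 atP moment_form X Y p.
Proof.
move=> hK hm sX sY; apply: (eq_trans (moment_metric_unique hK hm p _ _)).
apply: omega_d1 => // q x y.
exact: (proj1 (Phi_conditionsP q) (kahler_necessary hK hm q)).1.
Qed.
End Phi.
End Main.

Theorem theorem4p1 (R : realType) (n : nat) (G : lieGroupType R n)
    (I : bundle G -> {linear bundleTangent R n -> bundleTangent R n})
    (theta L : bundle G -> {linear bundleTangent R n -> lieAlg R n})
    (mu : bundle G -> lieDual R n)
    (Phi : bundle G -> 'Hom(lieDual R n, lieAlg R n))
    (I_complex : complex_structure (bundle_atlas G) I)
    (I_invariant : invariant_endo I)
    (I_decomposition : forall p v, exists! xy : lieAlg R n * lieAlg R n,
       v = fund xy.1 p + I p (fund xy.2 p))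
    (theta_def : forall p x y, theta p (fund x p + I p (fund y p)) = x)
    (L_def : forall p x y, L p (fund x p + I p (fund y p)) = y)
    (mu_smooth : smooth_dual mu)
    (mu_equivariant : coadjoint_equivariant mu)
    (mu_regular : regular theta mu)
    (Phi_def : forall p v, L p v = Phi p (cov_der theta mu p v)) :
  ((exists h : bundle G -> bundleTangent R n -> bundleTangent R n -> R,
      [/\ kahler_metric (bundle_atlas G) I h, invariant_metric h
        & moment_map I h mu])
   <->
   (forall p,
      let A := (ad_dual G (mu p) \o Phi p)%VF in
      [/\ dual_symmetric (Phi p), dual_posdef (Phi p)
        & dual_posdef (Phi p + (Phi p \o (A \o A))%VF)]))
  /\
  (forall h : bundle G -> bundleTangent R n -> bundleTangent R n -> R,
     kahler_metric (bundle_atlas G) I h -> invariant_metric h ->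
     moment_map I h mu ->
     (forall p v w,
        let Dmu := cov_der theta mu p in
        h p v w =
          Dmu w (Phi p (Dmu v))
          + ((Phi p)^-1)%VF (theta p v) (theta p w)
          + mu p (lie_bracket G (Phi p (Dmu v)) (theta p w)
                  - lie_bracket G (theta p v) (Phi p (Dmu w))))
     /\
     (forall X Y, smooth_vfield (bundle_atlas G) X ->
        smooth_vfield (bundle_atlas G) Y -> forall p,
        kahler_form I h p (X p) (Y p) =
          - d1 (bundle_atlas G) (fun q v => mu q (theta q v)) X Y p)).
Proof.
split.
  split=> [[h [h_kahler _ h_moment]]|Phi_cond].
    exact: (kahler_necessary I_complex I_decomposition theta_def L_def mu_smooth
      mu_equivariant mu_regular Phi_def h_kahler h_moment).
  exists (moment_metric I theta L mu); split.
  - exact: (moment_metric_kahler I_complex I_invariant I_decomposition theta_def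
      L_def mu_smooth mu_equivariant mu_regular Phi_def Phi_cond).
  - exact: moment_metric_invariant.
  - exact: moment_metric_moment_map.
move=> h h_kahler _ h_moment; split=> [p v w|X Y X_smooth Y_smooth p].
  have Phi_cond := kahler_necessary I_complex I_decomposition theta_def L_def
    mu_smooth mu_equivariant mu_regular Phi_def h_kahler h_moment p.
  apply: (eq_trans (moment_metric_unique I_decomposition theta_def L_def
    h_kahler h_moment p v w)).
  exact: (moment_metric_formula I_complex I_decomposition theta_def L_def
    mu_smooth mu_equivariant mu_regular Phi_def v w Phi_cond).
exact: (kahler_form_d1 I_complex I_invariant I_decomposition theta_def L_def
  mu_smooth mu_equivariant mu_regular Phi_def p h_kahler h_moment X_smooth Y_smooth).
Qed.
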